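(* Let $K$ be a number field, and let $f(z)=2z^3-3z^2+1$. Suppose there exist primes $\mathfrak{p}$ and $\mathfrak{q}$ of $K$ lying above $2$ and $3$, respectively, and an element $\alpha\in K$ such that [$v_{\mathfrak q}(\alpha)=1$ or $v_{\mathfrak q}(1-\alpha)=1$] and [$v_{\mathfrak p}(\alpha)=1$ or $v_{\mathfrak p}(1-\alpha)=1$]. Then for every $n\ge 1$: \begin{enumerate} \item the polynomial $f^n(z)-\alpha$ is irreducible over $K$; \item the $n$-th dynamical Galois group $\mathrm{Gal}_f^n(\alpha)$ is isomorphic to $E_n^2(3)$. \end{enumerate}
   Context: $f^n$ is the $n$-th iterate of $f$, $v_{\mathfrak p}$ is the normalized discrete valuation of $K$ at $\mathfrak p$ (value group $\mathbb{Z}$), and $\mathrm{Gal}_f^n(\alpha)$ is the Galois group over $K$ of the splitting field of $f^n(z)-\alpha$. $T_n(d)$ is the rooted $d$-ary tree with $n$ levels ($d^k$ vertices at level $k$ for $0\le k\le n$; every non-leaf vertex has $d$ children), and $\mathrm{Aut}(T_n(d))$ is its group of rooted automorphisms. For $m\le n$, $\mathrm{res}_m:\mathrm{Aut}(T_n(d))\to\mathrm{Aut}(T_m(d))$ is restriction to the first $m$ levels, $\mathrm{sgn}$ on $\mathrm{Aut}(T_m(d))$ is the sign of the induced permutation of the $d^m$ leaves, and $\mathrm{sgn}_m=\mathrm{sgn}\circ\mathrm{res}_m$. Identify $\mathrm{Aut}(T_n(d))\cong\mathrm{Aut}(T_{n-1}(d))\wr\mathrm{Aut}(T_1(d))$,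 where an element $((b_i)_i;a)$ consists of $a=$ its action on the $d$ vertices of level $1$ and of elements $b_i\in\mathrm{Aut}(T_{n-1}(d))$ describing the action on the $d$ subtrees below them. For odd $d$, define $E_1^2(d)=\mathrm{Aut}(T_1(d))=S_d$ and, for $n\ge 2$, $$E_n^2(d)=\bigl(E_{n-1}^2(d)\wr\mathrm{Aut}(T_1(d))\bigr)\cap\ker(\mathrm{sgn}_2)\subseteq \mathrm{Aut}(T_n(d)).$$ *)

(* Defs.v *)
From HB Require Import structures.
From mathcomp Require Import all_boot all_order all_algebra all_fingroup all_field.

Set Implicit Arguments.
Unset Strict Implicit.
Unset Printing Implicit Defensive.

Import GroupScope GRing.Theory.

(* The rooted d-ary tree T_n(d): a vertex is the word of length at most n      *)
(* spelled by the path from the root to it, so that the root is the empty word *)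
(* and the children of u are the words rcons u i.                              *)

Definition vertex (d n : nat) := n.-bseq 'I_d.

Definition root_vertex (d n : nat) : vertex d n := [bseq].

Definition is_child (d n : nat) (u v : vertex d n) : bool :=
  [exists i : 'I_d, v == rcons u i :> seq 'I_d].

Definition tree_aut (d n : nat) : {set {perm vertex d n}} :=
  [set s : {perm vertex d n} | (s (root_vertex d n) == root_vertex d n) &&
           [forall u, forall v, is_child (s u) (s v) == is_child u v]].

Definition level (d n m : nat) : {set vertex d n} :=
  [set u : vertex d n | size u == m].

(* The leaves of T_m(d) are the vertices of level m of T_n(d), and s acts on   *)
(* them in the same way as res_m(s). As for odd_perm, true means "odd".        *)
Definition sgn (d n m : nat) (s : {perm vertex d n}) : bool :=
  odd_perm (restr_perm (level d n m) s).

Definition ker_sgn (d n m : nat) : {set {perm vertex d n}} :=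
  [set s : {perm vertex d n} in tree_aut d n | ~~ sgn m s].

Definition below (d n : nat) (i : 'I_d) (w : vertex d n) : vertex d n.+1 :=
  [bseq of i :: w].

(* A wr Aut(T_1(d)), inside Aut(T_(n+1)(d)): the automorphisms ((b_i)_i; a)    *)
(* with every b_i in A. The subtree under i is identified with T_n(d) by       *)
(* deleting the first letter of words.                                         *)
Definition wreath (d n : nat) (A : {set {perm vertex d n}}) :
    {set {perm vertex d n.+1}} :=
  [set s : {perm vertex d n.+1} in tree_aut d n.+1 |
    [exists a : {perm 'I_d}, exists b : {ffun 'I_d -> {perm vertex d n}},
      [forall i, b i \in A] &&
      [forall i, forall w, s (below i w) == below (a i) (b i w)]]].

(* Only n >= 1 is meaningful.                                                  *)
Fixpoint E2 (d n : nat) : {set {perm vertex d n}} :=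
  match n with
  | 0 => tree_aut d 0
  | n'.+1 =>
      if n' is 0 then tree_aut d n'.+1
      else wreath (E2 d n') :&: ker_sgn d n'.+1 2
  end.

Lemma tree_aut_group_set d n : group_set (tree_aut d n).
Proof.
apply/group_setP; split=> [|s t].
  by rewrite inE perm1 eqxx; apply/'forall_forallP => u v; rewrite !perm1.
rewrite !inE => /andP[/eqP s0 /'forall_'forall_eqP sE].
move=> /andP[/eqP t0 /'forall_'forall_eqP tE].
rewrite permM s0 t0 eqxx; apply/'forall_'forall_eqP => u v.
by rewrite !permM tE sE.
Qed.

Canonical tree_aut_group d n := Group (tree_aut_group_set d n).

Lemma tree_aut_size d n s (u : vertex d n) :
  s \in tree_aut d n -> size (s u) = size u.
Proof.
rewrite inE => /andP[/eqP s0 /'forall_'forall_eqP sE].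
case: u => u; elim/last_ind: u => [|u i IH] ule.
  have -> : Bseq ule = root_vertex d n by apply: val_inj.
  by rewrite s0.
have u'le : size u <= n by rewrite (leq_trans _ ule) // size_rcons.
have /existsP[j /eqP ->] : is_child (s (Bseq u'le)) (s (Bseq ule)).
  by rewrite sE; apply/existsP; exists i.
by rewrite !size_rcons IH.
Qed.

Lemma tree_aut_norm d n m : tree_aut d n \subset 'N(level d n m | 'P).
Proof.
apply/subsetP => s sA; rewrite inE; apply/andP; split; first exact: in_setT.
rewrite inE; apply/subsetP => u.
by rewrite !inE /= apermE (tree_aut_size _ sA).
Qed.

Lemma ker_sgn_group_set d n m : group_set (ker_sgn d n m).
Proof.
apply/group_setP; split=> [|s t]; first by rewrite inE group1 /sgn morph1 odd_perm1.
rewrite 2![_ \in ker_sgn _ _ _]in_set => /andP[sA sE] /andP[tA tE].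
rewrite in_set groupM //= /sgn morphM ?(subsetP (tree_aut_norm d n m)) //.
by rewrite odd_permM -!/(sgn m _) (negPf sE) (negPf tE).
Qed.

Canonical ker_sgn_group d n m := Group (ker_sgn_group_set d n m).

Lemma wreath_group_set d n (A : {group {perm vertex d n}}) :
  group_set (wreath A).
Proof.
apply/group_setP; split=> [|s t].
  rewrite inE group1; apply/existsP; exists 1.
  apply/existsP; exists [ffun=> 1]; apply/andP; split.
    by apply/forallP => i; rewrite ffunE group1.
  by apply/'forall_'forall_eqP => i w; rewrite ffunE !perm1.
rewrite 2![_ \in wreath A]in_set.
move=> /andP[sA /existsP[a /existsP[b /andP[/forallP bA /'forall_'forall_eqP sE]]]].
move=> /andP[tA /existsP[a' /existsP[b' /andP[/forallP b'A /'forall_'forall_eqP tE]]]].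
rewrite in_set groupM //=; apply/existsP; exists (a * a').
apply/existsP; exists [ffun i => b i * b' (a i)]; apply/andP; split.
  by apply/forallP => i; rewrite ffunE groupM.
by apply/'forall_'forall_eqP => i w; rewrite ffunE !permM sE tE.
Qed.

Canonical wreath_group d n A := Group (@wreath_group_set d n A).

Lemma E2_group_set d n : group_set (E2 d n).
Proof.
case: n => [|n]; first exact: groupP.
elim: n => [|n IH]; first exact: groupP.
exact: (groupP (wreath_group (Group IH) :&: ker_sgn_group d n.+2 2)).
Qed.

Canonical E2_group d n := Group (E2_group_set d n).

Local Open Scope ring_scope.

(* Subsets of a number field are Prop-valued predicates, as membership in its  *)
(* ring of integers is an existential statement.                               *)
Definition alg_integer (K : fieldExtType rat) (x : K) : Prop :=
  integralOver (intr : int -> K) x.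

Record prime_ideal (K : fieldExtType rat) (P : K -> Prop) : Prop := PrimeIdeal {
  pideal_int : forall x : K, P x -> alg_integer x;
  pideal0 : P 0;
  pidealD : forall x y : K, P x -> P y -> P (x + y);
  pidealM : forall a x : K, alg_integer a -> P x -> P (a * x);
  pideal1 : ~ P 1;
  pideal_prime : forall a b : K, alg_integer a -> alg_integer b ->
    P (a * b) -> P a \/ P b
}.

Definition lies_above (K : fieldExtType rat) (P : K -> Prop) (l : nat) : Prop :=
  forall m : int, P m%:~R <-> (l%:Z %| m)%Z.

(* v is the normalized discrete valuation of K at the nonzero prime ideal P.   *)
(* The value +oo at 0 is replaced by the junk value 0, so that "v x = 1" still *)
(* entails x != 0.                                                             *)
Record normalized_valuation (K : fieldExtType rat) (P : K -> Prop)
    (v : K -> int) : Prop := NormalizedValuation {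
  nval0 : v 0 = 0;
  nvalM : forall x y : K, x != 0 -> y != 0 -> v (x * y) = v x + v y;
  nvalD : forall x y : K, x != 0 -> y != 0 -> x + y != 0 ->
    Num.min (v x) (v y) <= v (x + y);
  nval_onto : forall m : int, exists2 x : K, x != 0 & v x = m;
  nval_int : forall x : K, x != 0 -> alg_integer x -> 0 <= v x;
  nval_center : forall x : K, x != 0 -> alg_integer x -> (P x <-> 0 < v x)
}.

Definition fpoly (K : fieldType) : {poly K} := 2 *: 'X^3 - 3 *: 'X^2 + 1.

Definition iter_poly (K : fieldType) (f : {poly K}) (n : nat) : {poly K} :=
  iter n (fun g => f \Po g) 'X.

Definition splitting_field (K : fieldType) (g : {poly K})
    (L : splittingFieldType K) : Prop :=
  splittingFieldFor 1%VS (map_poly (in_alg L) g) {:L}%VS.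

(* Main.v *)
Require Import Defs.
From mathcomp Require Import all_boot all_order all_algebra all_fingroup all_solvable all_field.
From mathcomp Require Import zify ring.

(** Why the theorem is true.

    The polynomial f = 2z^3 - 3z^2 + 1 has the critical points 0 and 1 and
    exchanges them: for c in {0, 1},
      f(c + W) = (1 - c) + W^2 (2W + 6c - 3).
    Iterating, f^k(c + W) = c' + g_k(W) with c' in {0, 1} and g_k an integral
    polynomial which is W^(3^k) times a unit modulo 3, and is W^(2^k) times
    a polynomial with odd constant term ([increment_3adic],
    [increment_2adic]).  The hypotheses say that alpha is congruent to 0 or 1,
    exactly to the first order, at the two primes.

    At q this makes f^k(c + W) - alpha an Eisenstein polynomial, so every
    f^k - alpha is irreducible ([iter_irreducible]).  At p it makes
    w = y - c a uniformizer at a place of K(y) above p, for each root y of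
    f^k - alpha.  At that place 3y(1-y) has valuation 1 and, with x = f(y),
    3x(1-x) has valuation 2; hence neither 3y(1-y) nor the product of the two
    is a square in K(y) ([disc_nonsquare], [disc_prod_nonsquare]).

    The iterated preimages of alpha in the splitting field form a ternary tree
    on which the Galois group G acts.  The three preimages of x have a
    Vandermonde product Delta(x) with Delta(x)^2 = (27/4) x (1-x), and the
    product of y(1-y) over these preimages is x(1-x)/4.  So Delta(x) times the
    product of the Delta(y) is, up to sign, the rational expression
    (729/32) x (1-x), and the preimages can be numbered so that the sign is
    always + ([labelling_exists]).  Comparing with the conjugates gives one
    relation between the signs of the local permutations of a Galois element
    at a vertex and at its three children, which is membership in E_n^2(3)
    ([treeact_sign], [mem_E2_of_signs]).

    The converse inclusion is group theory ([E2_generated]).  The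
    nonsquareness statements say that, at each vertex, some element of G
    fixing it acts there by an odd permutation, and that on each edge some
    element of G fixing it has opposite local signs at the two ends.
    Inductively, the stabilizer in G of a vertex i of level 1 acts on the
    subtree below i through the whole group E = E_(n-1).  Let N be the
    subgroup of G acting trivially on level 1.  The derived subgroup of E is
    the kernel of its sign at level 1 ([der_E2]), and E is solvable; so
    already N maps onto E for each i ([N_full]).  If for i <> j the image of N
    in E x E were not everything, the signs at i and j would agree on N; by
    conjugation this would hold for all pairs, and as the three signs have
    product 1 they would all be trivial ([separate_some]).  From surjectivity
    onto pairs, commutators of elements trivial on different branches produce
    all elements of N supported on one branch with trivial sign, and these,
    with the elements found on the way, generate everything
    ([generate_step]). *)

Set Implicit Arguments.
Unset Strict Implicit.
Unset Printing Implicit Defensive.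

Import GroupScope GRing.Theory.
Local Open Scope group_scope.

(** * Tree automorphisms, local permutations and wreath coordinates *)

Section Tree.
Variable d : nat.
Implicit Types (n : nat) (i j : 'I_d).

(** The action on vertices transported to plain words, which makes induction on
    words possible.  Words of length above n are left alone, so that [ap s] is a
    bijection of all words and composition holds without side conditions. *)
Definition ap n (s : {perm vertex d n}) (u : seq 'I_d) : seq 'I_d :=
  if insub u is Some v then s v : seq _ else u.

Lemma apE n (s : {perm vertex d n}) (v : vertex d n) : ap s v = s v.
Proof. by rewrite /ap valK. Qed.

Lemma ap_over n (s : {perm vertex d n}) u : n < size u -> ap s u = u.
Proof. by move=> nu; rewrite /ap insubN // -ltnNge. Qed.

Lemma size_ap n (s : {perm vertex d n}) u : s \in tree_aut d n -> size (ap s u) = size u.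
Proof.
move=> sA; case: (leqP (size u) n) => [un|]; last by move/ap_over->.
by rewrite -[u]/(val (Bseq un)) apE (tree_aut_size _ sA).
Qed.

Lemma ap1 n u : ap (1 : {perm vertex d n}) u = u.
Proof.
case: (leqP (size u) n) => [un|]; last by move/ap_over->.
by rewrite -[u]/(val (Bseq un)) apE perm1.
Qed.

Lemma apM n (s t : {perm vertex d n}) u : ap (s * t) u = ap t (ap s u).
Proof.
case: (leqP (size u) n) => [un|nu]; last by rewrite !ap_over.
by rewrite -[u]/(val (Bseq un)) !apE permM.
Qed.

Lemma ap_inj n (s : {perm vertex d n}) : injective (ap s).
Proof.
by move=> u v /(congr1 (ap s^-1)); rewrite -!apM mulgV !ap1.
Qed.

Lemma ap_eq n (s t : {perm vertex d n}) :
  (forall u, size u <= n -> ap s u = ap t u) -> s = t.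
Proof.
move=> st; apply/permP => u; apply: val_inj; rewrite /= -!apE.
by apply: st; exact: size_bseq.
Qed.

Definition is_loc n (s : {perm vertex d n}) u (a : {perm 'I_d}) :=
  [forall i, ap s (rcons u i) == rcons (ap s u) (a i)].

Fact loc_key : unit. Proof. by []. Qed.
(** The local permutation of s at u: the effect of s on the children of u,
    read through the last letters.  The lock keeps unification from unfolding
    the choice operator. *)
Definition loc n (s : {perm vertex d n}) u : {perm 'I_d} :=
  locked_with loc_key (odflt 1 [pick a | is_loc s u a]).

Lemma is_loc_inj n (s : {perm vertex d n}) u a a' : is_loc s u a -> is_loc s u a' -> a = a'.
Proof.
move=> /forallP sa /forallP sa'; apply/permP => i.
have := sa i; rewrite (eqP (sa' i)) eqseq_rcons => /andP[_ /eqP].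
by [].
Qed.

Lemma is_loc_loc n (s : {perm vertex d n}) u a : is_loc s u a -> loc s u = a.
Proof.
move=> sa; rewrite /loc unlock; case: pickP => [a' sa'|/(_ a)]; last by rewrite sa.
exact: is_loc_inj sa' sa.
Qed.

Lemma ap_child n (s : {perm vertex d n}) u i : s \in tree_aut d n -> size u < n ->
  exists j, ap s (rcons u i) = rcons (ap s u) j.
Proof.
rewrite inE => /andP[_ /'forall_'forall_eqP sE] un.
have uin : size (rcons u i) <= n by rewrite size_rcons.
have /existsP[j /eqP sj] : is_child (s (Bseq (ltnW un))) (s (Bseq uin)).
  by rewrite sE; apply/existsP; exists i.
by exists j; rewrite -[rcons u i]/(val (Bseq uin)) -[u]/(val (Bseq (ltnW un))) !apE.
Qed.

Lemma tree_locP n (s : {perm vertex d n}) u : s \in tree_aut d n -> size u < n ->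
  is_loc s u (loc s u).
Proof.
move=> sA un.
have ex i : exists j, ap s (rcons u i) == rcons (ap s u) j.
  by have [j /eqP] := ap_child i sA un; exists j.
pose f i := xchoose (ex i).
have fE i : ap s (rcons u i) = rcons (ap s u) (f i) by apply/eqP/(xchooseP (ex i)).
have f_inj : injective f.
  move=> i j fij; have : ap s (rcons u i) = ap s (rcons u j) by rewrite !fE fij.
  by move/ap_inj/rcons_inj => [].
have sf : is_loc s u (perm f_inj) by apply/forallP => i; rewrite permE fE.
by rewrite (is_loc_loc sf).
Qed.

Lemma ap_rcons n (s : {perm vertex d n}) u i : s \in tree_aut d n -> size u < n ->
  ap s (rcons u i) = rcons (ap s u) (loc s u i).
Proof. by move=> sA un; apply/eqP; move/forallP: (tree_locP sA un). Qed.

Lemma ap_nil n (s : {perm vertex d n}) : s \in tree_aut d n -> ap s [::] = [::].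
Proof. by move=> sA; apply: size0nil; rewrite size_ap. Qed.

Lemma tree_autP n (s : {perm vertex d n}) :
  (forall u, size u <= n -> size (ap s u) = size u) ->
  (forall u i, size u < n -> exists j, ap s (rcons u i) = rcons (ap s u) j) ->
  s \in tree_aut d n.
Proof.
move=> sz ch; rewrite inE; apply/andP; split.
  by rewrite -val_eqE /= -apE /= -size_eq0 sz.
have chi u v : is_child u v -> is_child (s u) (s v).
  move=> /existsP[i /eqP vE]; apply/existsP.
  have un : size u < n by move: (size_bseq v); rewrite /= vE size_rcons.
  by have [j sj] := ch _ i un; exists j; rewrite -!apE vE sj.
apply/'forall_'forall_eqP => u v; apply/idP/idP; last exact: chi.
move=> /existsP[j /eqP vE].
have szv : size v = (size u).+1.
  by rewrite -sz ?(size_bseq v) // apE vE size_rcons -apE sz ?(size_bseq u).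
have [v' [i vE']] : exists v' i, bseqval v = rcons v' i.
  by move: szv; case/lastP: (bseqval v) => [//|v' i] _; exists v', i.
have v'n : size v' < n by move: (size_bseq v); rewrite /= vE' size_rcons.
have [k] := ch _ i v'n.
rewrite -vE' apE vE => /rcons_inj[/esym sv _].
by apply/existsP; exists i; rewrite vE'; apply/eqP; congr rcons; apply: (@ap_inj n s); rewrite apE.
Qed.

Section Wr.
Variable n : nat.
Implicit Types (a : {perm 'I_d}) (b : 'I_d -> {perm vertex d n}).

Definition wr_fun b a (w : vertex d n.+1) : vertex d n.+1 :=
  if val w is i :: u then insubd w (a i :: ap (b i) u) else w.

Lemma size_ap_le m (s : {perm vertex d m}) u : size u <= m -> size (ap s u) <= m.
Proof. by move=> um; rewrite -[u]/(val (Bseq um)) apE; exact: size_bseq. Qed.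

Lemma wr_fun_cons b a (w : vertex d n.+1) i u : val w = i :: u ->
  wr_fun b a w = a i :: ap (b i) u :> seq _.
Proof.
move=> wE; rewrite /wr_fun wE insubdK //.
by move: (size_bseq w); rewrite wE /= !ltnS; exact: size_ap_le.
Qed.

Lemma wr_inj b a : injective (wr_fun b a).
Proof.
move=> v w vw; apply: val_inj; move/(congr1 val): vw => /=.
case vE: (val v) => [|i u]; case wE: (val w) => [|j u'].
- by [].
- by rewrite (wr_fun_cons _ _ wE) /wr_fun vE vE.
- by rewrite (wr_fun_cons _ _ vE) /wr_fun wE wE.
rewrite (wr_fun_cons _ _ vE) (wr_fun_cons _ _ wE) => -[/perm_inj ij].
by rewrite ij => /ap_inj ->.
Qed.

(** Coordinates of the wreath recursion: permute the branches by [a], then act on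
    the i-th branch by [b i]. *)
Definition wr b a : {perm vertex d n.+1} := perm (@wr_inj b a).

Lemma ap_wr b a i u : size u <= n -> ap (wr b a) (i :: u) = a i :: ap (b i) u.
Proof.
move=> un; have iun : size (i :: u) <= n.+1 by [].
by rewrite -[i :: u]/(val (Bseq iun)) apE permE (@wr_fun_cons b a (Bseq iun) i u).
Qed.

Lemma ap_wr_nil b a : ap (wr b a) [::] = [::].
Proof.
have h : size ([::] : seq 'I_d) <= n.+1 by [].
by rewrite -{1}[[::]]/(val (Bseq h)) apE permE /wr_fun.
Qed.

Lemma wrM b a b' a' : wr b a * wr b' a' = wr (fun i => b i * b' (a i)) (a * a').
Proof.
apply: ap_eq => -[|i u] un; rewrite apM; first by rewrite !ap_wr_nil.
by rewrite !ap_wr ?size_ap_le // permM apM.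
Qed.

Lemma eq_wr b b' a : b =1 b' -> wr b a = wr b' a.
Proof.
by move=> bb; apply: ap_eq => -[|i u] un; rewrite ?ap_wr_nil ?ap_wr // bb.
Qed.

Lemma wr1 : wr (fun=> 1) 1 = 1.
Proof. by apply: ap_eq => -[|i u] un; rewrite ap1 ?ap_wr_nil ?ap_wr // perm1 ap1. Qed.

Lemma wrV b a : (wr b a)^-1 = wr (fun i => (b (a^-1 i))^-1) a^-1.
Proof.
apply: (mulgI (wr b a)); rewrite mulgV wrM mulgV -wr1.
by apply: eq_wr => i; rewrite permK mulgV.
Qed.

Lemma wr_eq b a b' a' : wr b a = wr b' a' -> a = a' /\ b =1 b'.
Proof.
move=> /(congr1 (@ap _)) E.
have h i u : size u <= n -> a i = a' i /\ ap (b i) u = ap (b' i) u.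
  by move=> un; move: (congr1 (@^~ (i :: u)) E); rewrite !ap_wr // => -[].
split=> [|i]; first by apply/permP => i; have [] := h i [::] isT.
by apply: ap_eq => u un; have [] := h i u un.
Qed.

Lemma loc_wr_nil b a : (forall i, b i \in tree_aut d n) -> loc (wr b a) [::] = a.
Proof.
move=> bA; apply: is_loc_loc; apply/forallP => i /=.
by rewrite ap_wr_nil ap_wr // ap_nil.
Qed.

Lemma loc_wr_cons b a i u : size u < n -> loc (wr b a) (i :: u) = loc (b i) u.
Proof.
move=> un; rewrite /loc !unlock; congr odflt; apply: eq_pick => c.
apply: eq_forallb => j; rewrite rcons_cons !ap_wr ?size_rcons ?(ltnW un) //.
by rewrite rcons_cons eqseq_cons eqxx.
Qed.

Lemma wr_tree b a : (forall i, b i \in tree_aut d n) -> wr b a \in tree_aut d n.+1.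
Proof.
move=> bA; apply: tree_autP => [[|i u] un|[|i u] j un].
- by rewrite ap_wr_nil.
- by rewrite ap_wr //= size_ap.
- by exists (a j); rewrite ap_wr_nil ap_wr // ap_nil.
- have {}un : size u < n by [].
  have [k bk] := ap_child j (bA i) un.
  by exists k; rewrite rcons_cons !ap_wr ?size_rcons ?(ltnW un) // bk.
Qed.

(** The coordinates are the local permutation at the root and, on each branch, the
    effect on the words without their first letter. *)
Lemma tree_wrP s : s \in tree_aut d n.+1 ->
  exists b a, (forall i, b i \in tree_aut d n) /\ s = wr b a.
Proof.
move=> sA; pose a := loc s [::].
have sE i u : size u <= n -> ap s (i :: u) = a i :: behead (ap s (i :: u)).
  elim/last_ind: u => [|u j IH] un.
    by rewrite -[[:: i]]/(rcons [::] i) ap_rcons // ap_nil.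
  rewrite size_rcons in un; rewrite -rcons_cons ap_rcons //.
  by rewrite (IH (ltnW un)).
pose bf i (w : vertex d n) : vertex d n := insubd w (behead (ap s (i :: w))).
have bfE i w : bf i w = behead (ap s (i :: w)) :> seq _.
  by rewrite /bf insubdK //= -topredE /= size_behead size_ap //= size_bseq.
have bf_inj i : injective (bf i).
  move=> v w /(congr1 val); rewrite /= !bfE => E; apply: val_inj => /=.
  have /ap_inj[] // : ap s (i :: v) = ap s (i :: w).
  by rewrite sE ?size_bseq // E -sE ?size_bseq.
pose b i := perm (bf_inj i).
have bE i u : size u <= n -> ap (b i) u = behead (ap s (i :: u)).
  by move=> un; rewrite -[u]/(val (Bseq un)) apE permE bfE.
exists b, a; split=> [i|].
  apply: tree_autP => [u un|u j un].
    by rewrite bE // size_behead size_ap.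
  exists (loc s (i :: u) j).
  rewrite !bE ?size_rcons ?(ltnW un) // -rcons_cons ap_rcons //.
  by rewrite (sE i u) ?(ltnW un).
apply: ap_eq => -[|i u] un; first by rewrite ap_nil // ap_wr_nil.
by rewrite ap_wr // bE // sE.
Qed.

Lemma wr_treeE b a : (wr b a \in tree_aut d n.+1) = [forall i, b i \in tree_aut d n].
Proof.
apply/idP/forallP => [/tree_wrP[b' [a' [bA /wr_eq[_ bb]]]] i|]; last exact: wr_tree.
by rewrite bb.
Qed.

Lemma mem_wreathP (A : {set {perm vertex d n}}) s : A \subset tree_aut d n ->
  reflect (exists b a, (forall i, b i \in A) /\ s = wr b a) (s \in wreath A).
Proof.
move=> sA; apply: (iffP idP).
  rewrite inE => /andP[sT] /existsP[a] /existsP[b] /andP[/forallP bA].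
  move=> /'forall_'forall_eqP E; exists b, a; split=> //.
  apply: ap_eq => -[|i u] un; first by rewrite ap_nil // ap_wr_nil.
  have un' : size u <= n by [].
  have -> : i :: u = val (below i (Bseq un')) by [].
  by rewrite apE E /= ap_wr // -[u in RHS]/(val (Bseq un')) apE.
move=> [b [a [bA ->]]]; rewrite inE wr_tree ?(subsetP sA) //=.
  apply/existsP; exists a; apply/existsP; exists (finfun b); apply/andP; split.
    by apply/forallP => i; rewrite ffunE.
  apply/'forall_'forall_eqP => i w; rewrite ffunE; apply: val_inj => /=.
  by rewrite -apE ap_wr ?size_bseq // apE.
by move=> i; apply: (subsetP sA).
Qed.
End Wr.
End Tree.

(** * The sign on the nine vertices of level 2 *)

(** Transporting a decomposition into transpositions along an injection keeps its
    length; so a permutation which copies s on the image of f and is trivial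
    elsewhere has the sign of s. *)
Lemma odd_perm_transfer (T T' : finType) (f : T -> T') (s : {perm T}) (s' : {perm T'}) :
  injective f -> (forall x, s' (f x) = f (s x)) ->
  (forall y, y \notin codom f -> s' y = y) -> odd_perm s' = odd_perm s.
Proof.
move=> f_inj s'f s'out; have [ts sE dts] := prod_tpermP s.
pose g (t : T * T) := (f t.1, f t.2).
have -> : s' = \prod_(t <- map g ts) tperm t.1 t.2.
  rewrite big_map; apply/permP => y; case: (boolP (y \in codom f)) => [/codomP[x ->]|yf].
    rewrite s'f sE; elim: (ts) x => [|t r IH] x; first by rewrite !big_nil !perm1.
    by rewrite !big_cons !permM /= -inj_tperm // IH.
  rewrite s'out //; elim: (ts) => [|t r IH]; first by rewrite big_nil perm1.
  rewrite big_cons permM tpermD //=; apply: contraNneq yf => <-; exact: codom_f.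
rewrite odd_perm_prod; last by rewrite all_map; apply: sub_all dts => t /=; rewrite /dpair /= (inj_eq f_inj).
by rewrite size_map sE odd_perm_prod.
Qed.

Section SignOfPairs.
Variables (T : finType).
Definition row_fun (c : 'I_3 -> {perm T}) (x : 'I_3 * T) := (x.1, c x.1 x.2).
Lemma row_fun_inj c : injective (row_fun c).
Proof. by move=> [i x] [j y] [/= -> /perm_inj ->]. Qed.
Definition row_perm c := perm (@row_fun_inj c).

Lemma row_permM c c' : row_perm c * row_perm c' = row_perm (fun i => c i * c' i).
Proof. by apply/permP => -[i x]; rewrite permM !permE /row_fun /= permM. Qed.

Definition single (k : 'I_3) (c : {perm T}) (i : 'I_3) : {perm T} := if i == k then c else 1.

Lemma odd_row1 k c : odd_perm (row_perm (single k c)) = odd_perm c.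
Proof.
apply: (@odd_perm_transfer _ _ (fun x => (k, x))) => [x y [] //|x|[i x] ix].
  by rewrite permE /row_fun /single /= eqxx.
rewrite permE /row_fun /single /=; case: eqP => [ik|_]; last by rewrite perm1.
by case/negP: ix; rewrite ik; apply: codom_f.
Qed.

Lemma odd_row c : odd_perm (row_perm c) = \big[addb/false]_i odd_perm (c i).
Proof.
have -> : row_perm c = \prod_(k < 3) row_perm (single k (c k)).
  rewrite !big_ord_recl big_ord0 mulg1 !row_permM; apply/permP => -[i x].
  by rewrite !permE /row_fun /single /=; case: i => [[|[|[|]]] ?] //=; rewrite !permM ?perm1;
    congr (_, fun_of_perm (c _) _); apply: val_inj.
rewrite (big_morph _ (@odd_permM _) (odd_perm1 _)).
by apply: eq_bigr => i _; rewrite odd_row1.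
Qed.
End SignOfPairs.

(** The permutation factors as row permutations c_i, then the permutation a of
    the rows; the latter acts as a in each of the three columns, which
    contributes its sign three times, hence once. *)
Lemma odd_pair (c : 'I_3 -> {perm 'I_3}) (a : {perm 'I_3}) (s : {perm 'I_3 * 'I_3}) :
  (forall x, s x = (a x.1, c x.1 x.2)) ->
  odd_perm s = odd_perm a (+) \big[addb/false]_i odd_perm (c i).
Proof.
move=> sE.
pose sw (x : 'I_3 * 'I_3) := (x.2, x.1).
have swK : involutive sw by case.
pose t := perm (inv_inj swK).
have tK : t * t = 1 by apply/permP => x; rewrite perm1 permM !permE swK.
have -> : s = row_perm c * (row_perm (fun=> a) ^ t).
  apply/permP => -[i j]; rewrite sE permM conjgE.
  have -> : t^-1 = t by apply: (mulgI t); rewrite mulgV tK.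
  by rewrite !permM !permE.
rewrite odd_permM odd_permJ !odd_row addbC; congr (_ (+) _).
by rewrite !big_ord_recl big_ord0; case: odd_perm.
Qed.

Lemma sgn2_wr n (b : 'I_3 -> {perm vertex 3 n.+1}) (a : {perm 'I_3}) :
  (forall i, b i \in tree_aut 3 n.+1) ->
  sgn 2 (wr b a) = odd_perm a (+) \big[addb/false]_i odd_perm (loc (b i) [::]).
Proof.
move=> bA; set s := wr b a.
have sA : s \in tree_aut 3 n.+2 by apply: wr_tree.
pose pf (x : 'I_3 * 'I_3) := (a x.1, loc (b x.1) [::] x.2).
have pf_inj : injective pf by move=> [i x] [j y] [/= /perm_inj -> /perm_inj ->].
rewrite -(@odd_pair (fun i => loc (b i) [::]) a (perm pf_inj)); last by move=> x; rewrite permE.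
pose f (x : 'I_3 * 'I_3) : vertex 3 n.+2 := [bseq of [:: x.1; x.2]].
have fX x : f x \in level 3 n.+2 2 by rewrite inE.
have sN : s \in 'N(level 3 n.+2 2 | 'P) by apply: (subsetP (tree_aut_norm _ _ _)).
apply: (@odd_perm_transfer _ _ f) => [[i x] [j y] /(congr1 val) [-> ->] //|x|y yf].
  rewrite restr_permE //; apply: val_inj; rewrite /= -apE ap_wr // permE /= /pf /=.
  by rewrite -[[:: x.2]]/(rcons [::] x.2) ap_rcons // ap_nil.
case: (boolP (y \in level 3 n.+2 2)) => [|yX]; last first.
  exact: (out_perm (restr_perm_on _ _) yX).
rewrite inE => szy; case/negP: yf.
case: y szy => [[|i [|j [|]]] //= ylt _].
by apply/codomP; exists (i, j); apply: val_inj.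
Qed.

Lemma E2_sub_tree d n : E2 d n \subset tree_aut d n.
Proof.
case: n => [|[|n]] //=; apply/subsetP => s; rewrite inE => /andP[].
by rewrite inE => /andP[].
Qed.

Lemma mem_E2P n s : reflect
  (exists b a, [/\ forall i, b i \in E2 3 n.+1, s = wr b a &
     odd_perm a (+) \big[addb/false]_i odd_perm (loc (b i) [::]) = false])
  (s \in E2 3 n.+2).
Proof.
have bT b : (forall i : 'I_3, b i \in E2 3 n.+1) -> forall i, b i \in tree_aut 3 n.+1.
  by move=> bE i; apply: (subsetP (E2_sub_tree _ _)).
have -> : (s \in E2 3 n.+2) = (s \in wreath (E2 3 n.+1)) && (s \in ker_sgn 3 n.+2 2).
  by rewrite -in_setI.
apply: (iffP andP) => [[/(mem_wreathP _ (E2_sub_tree 3 n.+1)) [b [a [bE ->]]]]|].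
  rewrite inE => /andP[_]; rewrite sgn2_wr; last exact: bT.
  by move/negbTE=> h; exists b, a.
move=> [b [a [bE -> sg]]]; split.
  by apply/(mem_wreathP _ (E2_sub_tree 3 n.+1)); exists b, a.
by rewrite inE wr_tree ?sgn2_wr ?sg //; apply: bT.
Qed.

(** E2 is cut out by one sign relation at each vertex that has grandchildren,
    since the definition imposes the relation at the root and recursively on the
    branches. *)
Lemma mem_E2_of_signs n (s : {perm vertex 3 n.+1}) : s \in tree_aut 3 n.+1 ->
  (forall u, (size u).+2 <= n.+1 ->
     odd_perm (loc s u) (+) \big[addb/false]_i odd_perm (loc s (rcons u i)) = false) ->
  s \in E2 3 n.+1.
Proof.
elim: n s => [//|n IH] s /tree_wrP[b [a [bA ->]]] sg.
apply/mem_E2P; exists b, a; split=> // [i|].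
  apply: IH => // u un; have := sg (i :: u) un.
  rewrite loc_wr_cons ?(leq_trans _ un) // => h; rewrite -[RHS]h; congr (_ (+) _).
  by apply: eq_bigr => j _; rewrite rcons_cons loc_wr_cons // size_rcons.
have := sg [::] isT; rewrite loc_wr_nil // => h; rewrite -[RHS]h; congr (_ (+) _).
by apply: eq_bigr => j _; rewrite loc_wr_cons.
Qed.

(** * Permutations of three letters *)

Lemma ord3_third (i j x y : 'I_3) : i != j -> x != i -> x != j -> y != i -> y != j -> x = y.
Proof.
rewrite -!val_eqE /= => ij xi xj yi yj; apply: val_inj => /=.
move: (ltn_ord i) (ltn_ord j) (ltn_ord x) (ltn_ord y); lia.
Qed.

Lemma ord3_other (i j : 'I_3) : exists l, l != i /\ l != j.
Proof.
have : exists2 l, l < 3 & (l != i) && (l != j).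
  case: i j => [[|[|[|]]]] // ? [[|[|[|]]]] // ?;
  first [by exists 0%N|by exists 1%N|by exists 2%N].
by case=> l l3 /andP[li lj]; exists (Ordinal l3).
Qed.

Lemma fix2_perm3 (a : 'S_3) i j : i != j -> a i = i -> a j = j -> a = 1.
Proof.
move=> ij ai aj; apply/permP => x; rewrite perm1.
have [-> //|xi] := eqVneq x i; have [-> //|xj] := eqVneq x j.
by apply: (ord3_third ij) => //; [rewrite -[X in _ != X]ai|rewrite -[X in _ != X]aj];
  rewrite (inj_eq perm_inj).
Qed.

(** If the permutation moved a letter, it would be a transposition. *)
Lemma even_fix_perm3 (a : 'S_3) i : a i = i -> odd_perm a = false -> a = 1.
Proof.
move=> ai oa; have [j [ji _]] := ord3_other i i; rewrite eq_sym in ji.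
have [/(fix2_perm3 ji ai) //|ajj] := eqVneq (a j) j.
have aji : a j != i by rewrite -[X in _ != X]ai (inj_eq perm_inj) eq_sym.
have E : a * tperm j (a j) = 1.
  by apply: (fix2_perm3 ji); rewrite permM ?tpermR // ai tpermD // eq_sym.
move: (congr1 (@odd_perm _) E).
by rewrite odd_permM oa odd_tperm odd_perm1 eq_sym ajj.
Qed.

Lemma card_Alt3 : #|'Alt_('I_3)| = 3.
Proof.
have := @card_Alt 'I_3; rewrite card_ord => /(_ isT) h.
by apply/eqP; rewrite -(eqn_pmul2l (isT : (0 < 2)%N)) h.
Qed.

(** A 3-cycle a is the commutator of a with any transposition t: t inverts a, so
    the commutator is the inverse of the square of a, which is a. *)
Lemma even_perm3_der (a : 'S_3) : odd_perm a = false -> a \in [set: 'S_3]^`(1).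
Proof.
move=> oa.
have a3 : a ^+ 3 = 1.
  have aA : a \in 'Alt_('I_3) by rewrite Alt_even oa.
  by have := expg_cardG aA; rewrite card_Alt3.
have [a0|na0] := eqVneq (a ord0) ord0; first by rewrite (even_fix_perm3 a0 oa) group1.
pose t := tperm ord0 (a ord0).
have tV : t^-1 = t by rewrite tpermV.
have ot : odd_perm t by rewrite odd_tperm eq_sym.
have atat : a * t * (a * t) = 1.
  apply: (@even_fix_perm3 _ ord0); last by rewrite !odd_permM oa ot.
  by rewrite !permM tpermR tpermR.
have -> : a = [~ a, t].
  rewrite commgEl conjgE tV.
  have -> : t * (a * t) = a^-1.
    by apply: (mulgI a); rewrite mulgV mulgA.
  by apply: (mulgI a); rewrite mulKVg; apply: (mulgI a); rewrite mulgV; exact: a3.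
by apply: mem_commg; rewrite inE.
Qed.

(** An odd permutation of three letters fixes one of them; by transitivity it can
    be conjugated to fix the letter 0, and then the point stabilizer is full. *)
Lemma trans_odd_perm3 (H : {group 'S_3}) : (forall i j, exists2 h, h \in H & h i = j) ->
  (exists2 h, h \in H & odd_perm h) -> H = [set: 'S_3] :> {set _}.
Proof.
move=> tH [h0 h0H oh0].
have [h [hH oh h00]] : exists h, [/\ h \in H, odd_perm h & h ord0 = ord0].
  have [e|ne] := eqVneq (h0 ord0) ord0; first by exists h0.
  have E : h0 = tperm ord0 (h0 ord0).
    apply: (mulIg (tperm ord0 (h0 ord0))); rewrite tperm2.
    apply: (@even_fix_perm3 _ ord0); first by rewrite permM tpermR.
    by rewrite odd_permM oh0 odd_tperm eq_sym ne.
  have [k [k0 kh]] := ord3_other ord0 (h0 ord0).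
  have h0k : h0 k = k by rewrite E tpermD // eq_sym.
  have [g gH gk] := tH k ord0; exists (h0 ^ g); split.
  - by rewrite groupJ.
  - by rewrite odd_permJ.
  - by rewrite conjgE !permM -gk permK h0k.
apply/eqP; rewrite eqEsubset subsetT; apply/subsetP => a _.
have [g gH g0] := tH ord0 (a ord0).
have f0 : (a * g^-1) ord0 = ord0 by rewrite permM -g0 permK.
have [o|o] := boolP (odd_perm (a * g^-1)).
  have : a * g^-1 * h^-1 = 1.
    apply: (@even_fix_perm3 _ ord0); first by rewrite permM f0 -{1}h00 permK.
    by rewrite odd_permM odd_permV o oh.
  by move/(canRL (mulgKV _)); rewrite mul1g => /(canRL (mulgKV _)) ->; rewrite groupM.
have := even_fix_perm3 f0 (negbTE o).
by move/(canRL (mulgKV _)); rewrite mul1g => ->.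
Qed.

Lemma S3_sol : solvable [set: 'S_3].
Proof.
have sA : 'Alt_('I_3) <| 'Sym_('I_3) := Alt_normal _.
have c3 := card_Alt3.
have c6 : #|'Sym_('I_3)| = 6 by rewrite card_Sym card_ord.
rewrite -[[set: _]]/('Sym_('I_3) : {set _}) (series_sol sA).
apply/andP; split; first by apply: abelian_sol; apply: cyclic_abelian; apply: prime_cyclic; rewrite c3.
apply: abelian_sol; apply: cyclic_abelian; apply: prime_cyclic.
by rewrite card_quotient ?normal_norm // -divgS ?normal_sub // c6 c3.
Qed.

(** * Top permutation and sections as homomorphisms; solvability *)

Lemma locM d n (s t : {perm vertex d n}) u : s \in tree_aut d n -> t \in tree_aut d n ->
  size u < n -> loc (s * t) u = loc s u * loc t (ap s u).
Proof.
move=> sA tA un; apply: is_loc_loc; apply/forallP => i.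
by rewrite !apM ap_rcons // ap_rcons // ?size_ap // permM.
Qed.

Section Top.
Variables (d n : nat).
Implicit Types (s t : {perm vertex d n.+1}) (b : 'I_d -> {perm vertex d n}).

Definition top s : {perm 'I_d} := loc s [::].

(** The sections of an automorphism at level 1.  They are packaged behind an opaque
    existence statement so that unification never unfolds the choice. *)
Lemma sec_exists : {f : {perm vertex d n.+1} -> {ffun 'I_d -> {perm vertex d n}} |
  forall s, s \in tree_aut d n.+1 -> s = wr (f s) (top s)}.
Proof.
exists (fun s => odflt [ffun=> 1]
  [pick b : {ffun 'I_d -> {perm vertex d n}} | s == wr b (top s)]) => s sA.
have [b [a [bA sE]]] := tree_wrP sA; case: pickP => [b' /eqP //|/(_ (finfun b))/eqP[]].
rewrite /top {2}sE loc_wr_nil // sE.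
by apply: eq_wr => i; rewrite ffunE.
Qed.

Definition sec := sval sec_exists.

Lemma wr_sec s : s \in tree_aut d n.+1 -> s = wr (sec s) (top s).
Proof. exact: (svalP sec_exists). Qed.

Lemma top_wr b a : (forall i, b i \in tree_aut d n) -> top (wr b a) = a.
Proof. exact: loc_wr_nil. Qed.

Lemma sec_wr b a i : (forall i, b i \in tree_aut d n) -> sec (wr b a) i = b i.
Proof. by move=> bA; have [_ <-] := wr_eq (wr_sec (wr_tree a bA)). Qed.

Lemma sec_tree s i : s \in tree_aut d n.+1 -> sec s i \in tree_aut d n.
Proof. by move=> sA; move: (sA); rewrite {1}(wr_sec sA) wr_treeE => /forallP/(_ i). Qed.

Lemma topM s t : s \in tree_aut d n.+1 -> t \in tree_aut d n.+1 -> top (s * t) = top s * top t.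
Proof. by move=> sA tA; rewrite /top locM // ap_nil. Qed.

Lemma secM s t i : s \in tree_aut d n.+1 -> t \in tree_aut d n.+1 ->
  sec (s * t) i = sec s i * sec t (top s i).
Proof.
move=> sA tA; rewrite {1}(wr_sec sA) {1}(wr_sec tA) wrM sec_wr // => j.
by rewrite groupM // sec_tree.
Qed.

Canonical top_morphism := Morphism topM.

(** The subgroup on which taking the section at i is a homomorphism. *)
Definition fix_branch (i : 'I_d) : {set {perm vertex d n.+1}} :=
  [set s in tree_aut d n.+1 | top s i == i].

Lemma fix_branchE i s : (s \in fix_branch i) = (s \in tree_aut d n.+1) && (top s i == i).
Proof. by rewrite in_set. Qed.

Lemma fix_branch_group_set i : group_set (fix_branch i).
Proof.
apply/group_setP; split=> [|s t]; first by rewrite fix_branchE group1 (morph1 top_morphism) perm1 eqxx.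
rewrite !fix_branchE => /andP[sA /eqP si] /andP[tA /eqP ti].
by rewrite groupM // topM // permM si ti eqxx.
Qed.
Canonical fix_branch_group i := Group (fix_branch_group_set i).

Lemma fix_branchP s i : s \in fix_branch i -> s \in tree_aut d n.+1 /\ top s i = i.
Proof. by rewrite fix_branchE => /andP[? /eqP]. Qed.

Definition sec_at i s := sec s i.
Lemma sec_atM i : {in fix_branch i &, {morph sec_at i : s t / s * t}}.
Proof.
move=> s t /fix_branchP[sA si] /fix_branchP[tA _].
by rewrite /sec_at secM // si.
Qed.
Canonical sec_at_morphism i := Morphism (sec_atM (i := i)).

Lemma topV s : s \in tree_aut d n.+1 -> top s^-1 = (top s)^-1.
Proof. exact: (morphV top_morphism). Qed.

Lemma secV s i : s \in tree_aut d n.+1 -> sec s^-1 i = (sec s ((top s)^-1 i))^-1.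
Proof.
move=> sA; rewrite {1}(wr_sec sA) wrV sec_wr // => j.
by rewrite groupV sec_tree.
Qed.

Lemma tree_eq s t : s \in tree_aut d n.+1 -> t \in tree_aut d n.+1 ->
  top s = top t -> (forall i, sec s i = sec t i) -> s = t.
Proof. by move=> sA tA e1 e2; rewrite (wr_sec sA) (wr_sec tA) e1; apply: eq_wr. Qed.
End Top.

Lemma vertex0_perm d (s : {perm vertex d 0}) : s = 1.
Proof.
have z (v : vertex d 0) : bseqval v = [::] by case: v => [[]].
by apply/permP => u; apply: val_inj; rewrite /= !z.
Qed.

(** The kernel of the map to the permutations of level 1 embeds by sections into
    three copies of the smaller group; as taking sections commutes with derived
    subgroups, the derived series of this kernel terminates. *)
Lemma tree_sol n : solvable (tree_aut 3 n).
Proof.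
elim: n => [|n IH].
  rewrite (_ : tree_aut _ _ = 1) ?solvable1 //.
  apply/trivgP/subsetP => s _; rewrite inE; apply/eqP/vertex0_perm.
rewrite (series_sol (ker_normal (top_morphism 3 n))).
apply/andP; split; last first.
  rewrite (isog_sol (first_isog (top_morphism 3 n))).
  exact: solvableS (subsetT _) S3_sol.
have [m Em] := derivedP _ IH.
apply/derivedP; exists m; apply/trivgP/subsetP => s sm; rewrite inE; apply/eqP.
have sK := subsetP (der_sub _ _) _ sm.
have sA : s \in tree_aut 3 n.+1 by apply: (subsetP (subsetIl _ _) _ sK).
have s1 : top s = 1 by apply: mker sK.
apply: tree_eq => //; first by rewrite s1 (morph1 (top_morphism 3 n)).
move=> i.
have Kb : 'ker (@top 3 n) \subset fix_branch n i.
  apply/subsetP => t tK; rewrite fix_branchE (subsetP (subsetIl _ _) _ tK) /=.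
  by rewrite (mker tK) perm1.
have : sec_at i s \in sec_at i @* (('ker (@top 3 n))^`(m)).
  by apply: mem_morphim => //; apply: (subsetP Kb).
rewrite morphim_der // => h.
have : sec_at i s \in (tree_aut 3 n)^`(m).
  apply: subsetP h; apply: dergS; apply/subsetP => _ /morphimP[t tb _ ->].
  by apply: sec_tree; case/fix_branchP: tb.
rewrite Em inE => /eqP; rewrite /sec_at => ->.
exact/esym/(morph1 (sec_at_morphism n i)).
Qed.

(** * Coordinates on E2 and a generation lemma *)

(** On E2 this is the sign character; for trees of height at least 2 it is also
    the product of the three characters of the branches, see [sg_E2]. *)
Definition top_sgn n (s : {perm vertex 3 n.+1}) : bool := odd_perm (top s).

Section Sign.
Variable n : nat.
Implicit Types (s t c : {perm vertex 3 n.+1}).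

Lemma E2_tree s : s \in E2 3 n.+1 -> s \in tree_aut 3 n.+1.
Proof. exact: (subsetP (E2_sub_tree _ _)). Qed.

Lemma top_sgn1 : top_sgn (1 : {perm vertex 3 n.+1}) = false.
Proof. by rewrite /top_sgn (morph1 (top_morphism 3 n)) odd_perm1. Qed.

Lemma top_sgnM s t : s \in E2 3 n.+1 -> t \in E2 3 n.+1 -> top_sgn (s * t) = top_sgn s (+) top_sgn t.
Proof. by move=> /E2_tree sA /E2_tree tA; rewrite /top_sgn topM // odd_permM. Qed.

Lemma top_sgnV s : s \in E2 3 n.+1 -> top_sgn s^-1 = top_sgn s.
Proof. by move=> /E2_tree sA; rewrite /top_sgn topV // odd_permV. Qed.

Definition even_part : {set {perm vertex 3 n.+1}} := [set s in E2 3 n.+1 | ~~ top_sgn s].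
Lemma even_part_group_set : group_set even_part.
Proof.
apply/group_setP; split=> [|s t]; first by rewrite in_set group1 top_sgn1.
rewrite !in_set => /andP[sE ss] /andP[tE st].
by rewrite groupM //= top_sgnM // (negbTE ss) (negbTE st).
Qed.
Canonical even_part_group := Group even_part_group_set.

Lemma der_sub_even : (E2 3 n.+1)^`(1) \subset even_part.
Proof.
rewrite gen_subG; apply/subsetP => _ /imset2P[s t sE tE ->].
have cE : [~ s, t] \in E2 3 n.+1 by rewrite groupR.
by rewrite in_set cE commgEl top_sgnM ?groupV ?groupJ // conjgE !top_sgnM ?groupM ?groupV // !top_sgnV //; case: top_sgn; case: top_sgn.
Qed.

Lemma der_top_sgn s : s \in (E2 3 n.+1)^`(1) -> top_sgn s = false.
Proof. by move/(subsetP der_sub_even); rewrite in_set => /andP[_ /negbTE]. Qed.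
End Sign.

Lemma addb_sum3 (F : 'I_3 -> bool) i j l : i != j -> l != i -> l != j ->
  \big[addb/false]_k F k = F i (+) F j (+) F l.
Proof.
move=> ij li lj; rewrite (bigD1 i) //= (bigD1 j) 1?eq_sym //= (bigD1 l) ?li ?lj //=.
rewrite big1 ?addbF ?addbA // => k /andP[/andP[ki kj] kl].
by rewrite (ord3_third ij ki kj li lj) eqxx in kl.
Qed.

Section Step.
Variable n : nat.
Local Notation E := (E2 3 n.+1).
Local Notation W := (E2 3 n.+2).
Implicit Types (s t : {perm vertex 3 n.+2}) (b : 'I_3 -> {perm vertex 3 n.+1}).

Lemma wr_E2E b a : (wr b a \in W) =
  [forall i, b i \in E] && (odd_perm a (+) \big[addb/false]_i top_sgn (b i) == false).
Proof.
apply/idP/andP => [/mem_E2P[b' [a' [bE /wr_eq[-> bb] sg]]]|[/forallP bE /eqP sg]].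
  split; first by apply/forallP => i; rewrite bb.
  by rewrite -{}[X in _ == X]sg; apply/eqP; congr (_ (+) _); apply: eq_bigr => i _; rewrite bb.
by apply/mem_E2P; exists b, a; split.
Qed.

Lemma sec_E2 s i : s \in W -> sec s i \in E.
Proof.
move=> sW; move: (sW); rewrite {1}(wr_sec (E2_tree sW)) wr_E2E.
by case/andP => /forallP/(_ i).
Qed.

Lemma sg_E2 s : s \in W -> top_sgn s = \big[addb/false]_i top_sgn (sec s i).
Proof.
move=> sW; move: (sW); rewrite {1}(wr_sec (E2_tree sW)) wr_E2E => /andP[_ /eqP].
by move/(canRL (addbK _)); rewrite /top_sgn addFb => <-.
Qed.

Lemma wr_E2_tree b a : wr b a \in W -> forall i, b i \in tree_aut 3 n.+1.
Proof. by rewrite wr_E2E => /andP[/forallP bE _] i; apply: E2_tree. Qed.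

Definition at_branch (i : 'I_3) (c : {perm vertex 3 n.+1}) : {perm vertex 3 n.+2} :=
  wr (single i c) 1.

Lemma at_branchM i c c' : at_branch i (c * c') = at_branch i c * at_branch i c'.
Proof.
rewrite /at_branch wrM mul1g; apply: eq_wr => j; rewrite perm1 /single.
by case: eqP => _; rewrite ?mulg1.
Qed.

Canonical at_branch_morphism i := Morphism (D := setT) (in2W (at_branchM i)).

(** The elements of E2 trivial on level 1 have an even number of odd sections.
    Modulo those with only even sections, they form a Klein four-group whose
    nontrivial elements are odd at all branches but one. *)
Lemma kernel_generated (H : {group {perm vertex 3 n.+2}}) : H \subset W ->
  (forall i c, c \in even_part n -> at_branch i c \in H) ->
  (forall i, exists2 s, s \in H & top s = 1 /\ forall j, top_sgn (sec s j) = (j != i)) ->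
  forall s, s \in W -> top s = 1 -> s \in H.
Proof.
move=> HW h1 h2.
have h0 s : s \in W -> top s = 1 -> (forall i, top_sgn (sec s i) = false) -> s \in H.
  move=> sW s1 sg.
  have -> : s = at_branch 0%R (sec s 0%R) * at_branch 1%R (sec s 1%R) * at_branch 2%R (sec s 2%R).
    rewrite {1}(wr_sec (E2_tree sW)) s1 /at_branch !wrM !mul1g; apply: eq_wr => i.
    rewrite !perm1 /single; case: i => [[|[|[|]]] ilt] //=; rewrite ?mulg1 ?mul1g;
    congr (sec s _); exact: val_inj.
  by rewrite !groupM // h1 // in_set sec_E2 //= sg.
move=> s sW s1.
have tr s' : s' \in H -> top s' = 1 -> (forall i, top_sgn (sec s' i) = top_sgn (sec s i)) -> s \in H.
  move=> s'H s'1 sg; rewrite -(groupMr _ s'H).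
  have s'W := subsetP HW _ s'H.
  apply: h0 => [||i]; first exact: groupM.
    by rewrite topM ?E2_tree // s1 s'1 mul1g.
  by rewrite secM ?E2_tree // top_sgnM ?sec_E2 // s1 perm1 sg addbb.
have := sg_E2 sW; rewrite {1}/top_sgn s1 odd_perm1 => sg.
case: (boolP [forall i, ~~ top_sgn (sec s i)]) => [/forallP h|].
  by apply: h0 => // i; apply/negbTE.
rewrite negb_forall => /existsP[j]; rewrite negbK => sj.
(* The three signs have product 1 and j is odd, so exactly one section is even. *)
have [i ij si] : exists2 i, i != j & top_sgn (sec s i) = false.
  have [i [ij _]] := ord3_other j j; have [l [li lj]] := ord3_other i j.
  move: sg; rewrite (addb_sum3 _ ij li lj) /= sj.
  by case E1: (top_sgn (sec s i)); [exists l | exists i] => //; move: sg; case: top_sgn.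
have [s' s'H [s'1 s's]] := h2 i; apply: (tr _ s'H s'1) => k; rewrite s's.
have [->|ki] := eqVneq k i; first by rewrite si.
have [->|kj] := eqVneq k j; first by rewrite sj.
by move: sg; rewrite (addb_sum3 _ ij ki kj) /= si sj; case: top_sgn.
Qed.
End Step.

Lemma odd_E2 n : exists2 s, s \in E2 3 n.+1 & top_sgn s.
Proof.
pose t : 'S_3 := tperm 0%R 1%R.
elim: n => [|n [x xE ox]].
  exists (wr (fun=> 1) t); first by apply: wr_tree => i; rewrite group1.
  by rewrite /top_sgn top_wr ?odd_tperm // => i; rewrite group1.
have sW : wr (single 0%R x) t \in E2 3 n.+2.
  rewrite wr_E2E; apply/andP; split.
    by apply/forallP => i; rewrite /single; case: eqP.
  by rewrite (@addb_sum3 _ 0%R 1%R 2%R) // /single /= !top_sgn1 ox odd_tperm.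
exists (wr (single 0%R x) t) => //.
by rewrite /top_sgn top_wr ?odd_tperm //; apply: wr_E2_tree sW.
Qed.

(** * The derived subgroup of E2 *)

Section Derived.
Variable n : nat.
Local Notation E := (E2 3 n.+1).
Local Notation W := (E2 3 n.+2).

(** The two factors commute outside the branch i, since on each of the two other
    branches one of them is trivial. *)
Lemma commutator_at_branch (s t : {perm vertex 3 n.+2}) i j l : s \in W -> t \in W ->
  top s = 1 -> top t = 1 -> i != j -> l != i -> l != j -> sec s j = 1 -> sec t l = 1 ->
  [~ s, t] = at_branch i [~ sec s i, sec t i].
Proof.
move=> sW tW s1 t1 ij li lj sj tl.
have [sT tT] := (E2_tree sW, E2_tree tW).
have sE : s = wr (sec s) 1 by rewrite -s1 -wr_sec.
have tE : t = wr (sec t) 1 by rewrite -t1 -wr_sec.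
rewrite [in LHS]sE [in LHS]tE commgEl conjgE !wrV !wrM invg1 !mul1g.
apply: eq_wr => k; rewrite !perm1 /single.
have [->|ki] := eqVneq k i; first by [].
have [->|kj] := eqVneq k j; first by rewrite sj invg1 !mul1g mulVg.
by rewrite (ord3_third ij ki kj li lj) tl invg1 !mulg1 mul1g mulVg.
Qed.

Lemma der_top_full : (forall a : 'S_3, exists2 s, s \in W & top s = a) ->
  forall a : 'S_3, odd_perm a = false -> exists2 s, s \in W^`(1) & top s = a.
Proof.
move=> onto a /even_perm3_der.
have WT : W \subset tree_aut 3 n.+2 by apply: E2_sub_tree.
have -> : [set: 'S_3] = @top 3 n.+1 @* W.
  apply/eqP; rewrite eq_sym eqEsubset subsetT; apply/subsetP => c _.
  have [s sW <-] := onto c; exact: (mem_morphim (top_morphism 3 n.+1) (E2_tree sW) sW).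
rewrite -morphim_der // => /morphimP[s _ sD ->]; by exists s.
Qed.

Lemma top_onto (a : 'S_3) : exists2 s, s \in W & top s = a.
Proof.
have [x xE ox] := odd_E2 n.
have sW : wr (single 0%R (if odd_perm a then x else 1)) a \in W.
  rewrite wr_E2E; apply/andP; split.
    by apply/forallP => i; rewrite /single; case: eqP => _ //; case: ifP => _.
  rewrite (@addb_sum3 _ 0%R 1%R 2%R) // /single /= !top_sgn1.
  by case: odd_perm; rewrite ?ox ?top_sgn1.
exists (wr (single 0%R (if odd_perm a then x else 1)) a) => //.
by rewrite top_wr //; apply: wr_E2_tree sW.
Qed.
End Derived.

(** Together with [der_sub_even] this computes the derived subgroup of E2.  By
    induction, commutators of elements that are trivial on different branches
    give all elements supported on one branch with even section.  Commutators
    with an element exchanging two branches give the sign patterns required by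
    [kernel_generated], and the derived subgroup of S_3 takes care of level 1. *)
Lemma even_part_der n : even_part n \subset (E2 3 n.+1)^`(1).
Proof.
elim: n => [|n IH].
  apply/subsetP => s; rewrite in_set => /andP[sE /negbTE /even_perm3_der].
  have -> : [set: 'S_3] = @top 3 0 @* (tree_aut 3 1).
    apply/eqP; rewrite eq_sym eqEsubset subsetT; apply/subsetP => c _.
    have bA (i : 'I_3) : (fun=> 1 : {perm vertex 3 0}) i \in tree_aut 3 0 by rewrite group1.
    by rewrite -(top_wr c bA); apply: mem_morphim; apply: wr_tree.
  rewrite -morphim_der // => /morphimP[t tT tD st].
  rewrite (_ : s = t) //; apply: tree_eq => // i.
  by rewrite [LHS]vertex0_perm [RHS]vertex0_perm.
pose C := [group of (E2 3 n.+2)^`(1)].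
have CW : C \subset E2 3 n.+2 by apply: der_sub.
have h1 i c : c \in even_part n -> at_branch i c \in C.
  move=> cE; have {cE} : c \in (E2 3 n.+1)^`(1) by apply: (subsetP IH).
  suff: (E2 3 n.+1)^`(1) \subset at_branch i @*^-1 C.
    by move=> sub /(subsetP sub); rewrite inE => /andP[_]; rewrite inE.
  rewrite gen_subG; apply/subsetP => _ /imset2P[x y xE yE ->].
  rewrite !inE /=.
  have [j [ji _]] := ord3_other i i; rewrite eq_sym in ji.
  have [l [li lj]] := ord3_other i j.
  (* To put c' at the branch i within E2, it is repeated at a branch k. *)
  pose f c' k (m : 'I_3) := if (m == i) || (m == k) then c' else 1 : {perm vertex 3 n.+1}.
  have fW c' k : c' \in E2 3 n.+1 -> k != i -> wr (f c' k) 1 \in E2 3 n.+2.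
    move=> c'E ki; rewrite wr_E2E; apply/andP; split.
      by apply/forallP => m; rewrite /f; case: ifP => // _; apply: group1.
    have [m [mi mk]] := ord3_other i k.
    rewrite eq_sym in ki; rewrite (addb_sum3 _ ki mi mk) /f !eqxx orbT (negbTE mi) (negbTE mk) /=.
    by rewrite odd_perm1 top_sgn1 addbb.
  have li' : l != i := li.
  have ji' : j != i by rewrite eq_sym.
  have sW := fW x l xE li'; have tW := fW y j yE ji'.
  have := @commutator_at_branch n (wr (f x l) 1) (wr (f y j) 1) i j l sW tW.
  rewrite !top_wr; try exact: wr_E2_tree sW; try exact: wr_E2_tree tW.
  rewrite !sec_wr; try exact: wr_E2_tree sW; try exact: wr_E2_tree tW.
  rewrite /f !eqxx (negbTE ji') (negbTE li') /= [j == l]eq_sym [l == j](negbTE lj) /=.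
  by move=> /(_ erefl erefl ji isT isT erefl erefl) <-; apply: mem_commg.
have [x xE ox] := odd_E2 n.
have h2 i : exists2 s, s \in C & top s = 1 /\ forall j, top_sgn (sec s j) = (j != i).
  have [j [ji _]] := ord3_other i i; rewrite eq_sym in ji.
  have [l [li lj]] := ord3_other i j.
  have ji' : j != i by rewrite eq_sym.
  have jl : j != l by rewrite eq_sym.
  have il : i != l by rewrite eq_sym.
  (* Conjugating v, odd at i and j, by g, which exchanges j and l, gives an element
     odd at i and l; the product is odd at j and l. *)
  pose v := fun m : 'I_3 => if (m == i) || (m == j) then x else 1 : {perm vertex 3 n.+1}.
  have vW : wr v 1 \in E2 3 n.+2.
    rewrite wr_E2E; apply/andP; split.
      by apply/forallP => m; rewrite /v; case: ifP => // _; apply: group1.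
    rewrite (addb_sum3 _ ji li lj) /v !eqxx orbT (negbTE li) (negbTE lj) /=.
    by rewrite odd_perm1 top_sgn1 addbb.
  have gW : wr (single i x) (tperm j l) \in E2 3 n.+2.
    rewrite wr_E2E; apply/andP; split.
      by apply/forallP => m; rewrite /single; case: ifP => // _; apply: group1.
    rewrite (addb_sum3 _ ji li lj) /single !eqxx (negbTE li) (negbTE ji') /=.
    by rewrite odd_tperm jl !top_sgn1 ox.
  have cW := groupR vW gW.
  exists [~ wr v 1, wr (single i x) (tperm j l)]; first exact: mem_commg.
  have vE m : v m \in E2 3 n.+1 by rewrite /v; case: ifP => // _; apply: group1.
  have gE m : single i x m \in E2 3 n.+1 by rewrite /single; case: ifP => // _; apply: group1.
  move: cW; rewrite commgEl conjgE !wrV !wrM => cW; split.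
    by rewrite top_wr; [rewrite invg1 !mul1g mulVg | apply: wr_E2_tree cW].
  move=> m; rewrite sec_wr; last exact: wr_E2_tree cW.
  rewrite !(top_sgnM, top_sgnV) ?groupM ?groupV //.
  rewrite invg1 !perm1 tpermV [X in _ (+) X]addbCA addbb addbF.
  have [->|mi] := eqVneq m i; first by rewrite tpermD // /v eqxx /= ox.
  have [->|mj] := eqVneq m j.
    by rewrite tpermL /v eqxx orbT (negbTE li) (negbTE lj) /= ox top_sgn1.
  rewrite (ord3_third ji mi mj li lj) tpermR /v eqxx orbT (negbTE li) (negbTE lj) /=.
  by rewrite top_sgn1 ox.
apply/subsetP => w; rewrite in_set => /andP[wW /negbTE ow].
have [s sC sw] := der_top_full (@top_onto n) ow.
have sW := subsetP CW _ sC.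
rewrite -(groupMr _ (groupVr sC)).
apply: (kernel_generated CW h1 h2); first by rewrite groupM ?groupV.
rewrite topM ?E2_tree ?groupV // topV ?E2_tree // sw mulgV //.
Qed.

(** * A criterion for a subgroup of E2 to be all of E2 *)

Lemma ap_sec d n (s : {perm vertex d n.+1}) i u : s \in tree_aut d n.+1 -> size u <= n ->
  ap s (i :: u) = top s i :: ap (sec s i) u.
Proof. by move=> sA un; rewrite {1}(wr_sec sA) ap_wr. Qed.

Lemma loc_sec d n (s : {perm vertex d n.+1}) i u : s \in tree_aut d n.+1 -> size u < n ->
  loc s (i :: u) = loc (sec s i) u.
Proof. by move=> sA un; rewrite {1}(wr_sec sA) loc_wr_cons. Qed.

Lemma der_E2 n : (E2 3 n.+1)^`(1) = even_part n.
Proof. by apply/eqP; rewrite eqEsubset der_sub_even even_part_der. Qed.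

(** Otherwise the quotient would be solvable and nontrivial, hence different from
    its derived subgroup.  But the derived subgroup has index 2 and the normal
    subgroup meets the other coset, so the quotient is perfect. *)
Lemma normal_odd_full n (A : {group {perm vertex 3 n.+1}}) : A <| E2 3 n.+1 ->
  (exists2 s, s \in A & top_sgn s) -> A = E2 3 n.+1 :> {set _}.
Proof.
move=> nA [x xA ox]; have [sA nAE] := andP nA.
apply/eqP; rewrite eqEsubset sA /=; pose E := E2_group 3 n.+1.
have solE : solvable (E / A).
  by apply: quotient_sol; apply: solvableS (tree_sol n.+1); apply: E2_sub_tree.
rewrite -quotient_sub1 // -[_ \subset _]negbK; apply/negP => n1.
have := sol_der1_proper solE (subxx _) _; rewrite -subG1 => /(_ n1).
rewrite properE => /andP[_ /negP[]].
rewrite -quotient_der //= der_E2; apply/subsetP => _ /morphimP[s sN sE ->].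
case os: (top_sgn s); last by apply: mem_quotient; rewrite in_set sE os.
have xE := subsetP sA _ xA.
have e : coset A s = coset A (s * x).
  by rewrite morphM ?(subsetP nAE) //= (coset_id xA) mulg1.
by rewrite /= e; apply: mem_quotient; rewrite in_set groupM // top_sgnM // os ox.
Qed.

(** The next three properties hold for Galois groups by arithmetic, and together
    they force a subgroup of E2 to be all of E2. *)
Definition level_transitive m (H : {set {perm vertex 3 m}}) :=
  forall u v : seq 'I_3, size u = size v -> size u <= m -> exists2 g, g \in H & ap g u = v.
Definition odd_at_vertex m (H : {set {perm vertex 3 m}}) :=
  forall u : seq 'I_3, size u < m ->
    exists2 g, g \in H & ap g u = u /\ odd_perm (loc g u).
Definition odd_at_edge m (H : {set {perm vertex 3 m}}) :=
  forall (u : seq 'I_3) i, (size u).+1 < m ->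
    exists2 g, g \in H & ap g (rcons u i) = rcons u i /\
       odd_perm (loc g u) (+) odd_perm (loc g (rcons u i)).

Lemma top_full n (G : {group {perm vertex 3 n.+1}}) : G \subset tree_aut 3 n.+1 -> level_transitive G -> odd_at_vertex G ->
  forall a, exists2 g, g \in G & top g = a.
Proof.
move=> GT T S1 a.
have := @trans_odd_perm3 (@top 3 n @* G)%G _ _ => /= H.
have : a \in @top 3 n @* G.
  rewrite H ?inE // => [i j|].
    have [g gG gi] := T [:: i] [:: j] erefl isT; exists (top g).
      by apply: mem_morphim => //; apply: (subsetP GT).
    by move: gi; rewrite ap_sec ?(subsetP GT) // => -[].
  have [g gG [_ o]] := S1 [::] isT; exists (top g) => //.
  by apply: mem_morphim => //; apply: (subsetP GT).
by case/morphimP => g _ gG ->; exists g.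
Qed.

(** The inductive step: [branch_full] is what the induction hypothesis says
    about the stabilizers of the vertices of level 1. *)
Section GenerateStep.
Variable n : nat.
Local Notation E := (E2 3 n.+1).
Local Notation W := (E2 3 n.+2).
Variable G : {group {perm vertex 3 n.+2}}.
Hypothesis GW : G \subset W.
Hypothesis onto : forall a, exists2 g, g \in G & top g = a.
Hypothesis branch_full : forall i, @sec_at 3 n.+1 i @* (G :&: fix_branch n.+1 i) = E.
Hypothesis edge : forall i, exists2 g, g \in G & top g i = i /\ odd_perm (top g) (+) top_sgn (sec g i).

Let N := [group of G :&: 'ker (@top 3 n.+1)].

Let GT s : s \in G -> s \in tree_aut 3 n.+2.
Proof. by move/(subsetP GW)/E2_tree. Qed.

Let NP s : reflect (s \in G /\ top s = 1) (s \in N).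
Proof.
rewrite inE; apply: (iffP andP) => -[sG sK]; split=> //; first exact: mker sK.
by apply/kerP => //; apply: GT.
Qed.

Let N_branch i : N \subset fix_branch n.+1 i.
Proof. by apply/subsetP => s /NP[sG s1]; rewrite fix_branchE GT //= s1 perm1. Qed.

Let NN : N <| G.
Proof.
rewrite /N /=; apply: (normalGI (subset_trans GW (E2_sub_tree _ _))).
exact: ker_normal.
Qed.

Let NG : N \subset G. Proof. exact: normal_sub NN. Qed.

(** If neither the element given by [edge] nor an element odd at i is trivial on
    level 1, both act there by the transposition fixing i; then the first one is
    even at i, and their product is trivial on level 1 and odd at i. *)
Lemma branch_odd i : exists2 s, s \in N & top_sgn (sec s i).
Proof.
have [s sG [si os]] := edge i.
have [o|o] := boolP (odd_perm (top s)); last first.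
  exists s; last by rewrite (negbTE o) in os.
  by apply/NP; split=> //; apply: (even_fix_perm3 si); apply/negbTE.
rewrite o /= in os.
have [x xE ox] := odd_E2 n; have := xE; rewrite -(branch_full i).
move=> /morphimP[t tb /setIP[tG _] xt]; have [_ ti] := fix_branchP tb.
rewrite {}xt /sec_at {xE} in ox.
have [o'|o'] := boolP (odd_perm (top t)); last first.
  by exists t => //; apply/NP; split=> //; apply: (even_fix_perm3 ti); apply/negbTE.
exists (t * s).
  apply/NP; split; first by rewrite groupM.
  rewrite topM ?GT //; apply: (@even_fix_perm3 _ i); first by rewrite permM ti.
  by rewrite odd_permM o o'.
rewrite secM ?GT // ti top_sgnM ?sec_E2 ?(subsetP GW) //.
by rewrite ox (negbTE os).
Qed.

(** The stabilizer of i acts on level 1 through a group of order 2, so its derived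
    subgroup lies in N, and the image of N contains the derived subgroup of E.
    The latter has index 2, and N contains an element that is odd at i. *)
Lemma N_full i : @sec_at 3 n.+1 i @* N = E.
Proof.
apply/eqP; rewrite eqEsubset; apply/andP; split.
  by rewrite -(branch_full i) morphimS // subsetI NG N_branch.
have der : E^`(1) \subset @sec_at 3 n.+1 i @* N.
  rewrite -(branch_full i) -morphim_der ?subsetIr // morphimS //.
  rewrite gen_subG; apply/subsetP => _ /imset2P[s t /setIP[sG /fix_branchP[_ si]] /setIP[tG /fix_branchP[_ ti]] ->].
  apply/NP; split; first exact: groupR.
  have fV (a : 'S_3) : a i = i -> a^-1 i = i by move=> ai; rewrite -{1}ai permK.
  rewrite commgEl conjgE !topM ?groupM ?groupV ?GT // !topV ?GT //.
  apply: (@even_fix_perm3 _ i); first by rewrite !permM !fV // si ti.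
  by rewrite !odd_permM !odd_permV; case: odd_perm; case: odd_perm.
have [x xN ox] := branch_odd i.
have xI : sec x i \in @sec_at 3 n.+1 i @* N.
  by apply: (@mem_morphim _ _ _ (sec_at_morphism n.+1 i)) => //; apply: (subsetP (N_branch i)).
have xE : sec x i \in E by apply: sec_E2; apply: (subsetP GW); apply: (subsetP NG).
apply/subsetP => c cE; case oc: (top_sgn c); last first.
  by apply: (subsetP der); rewrite der_E2 in_set cE oc.
rewrite -(groupMr _ xI); apply: (subsetP der).
by rewrite der_E2 in_set groupM //= top_sgnM // oc ox.
Qed.

Let NE s i : s \in N -> sec s i \in E.
Proof. by move=> sN; apply: sec_E2; apply: (subsetP GW); apply: (subsetP NG). Qed.

Let sec_derN s i : s \in N^`(1) -> top_sgn (sec s i) = false.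
Proof.
move=> sN; apply: der_top_sgn; rewrite -(N_full i) -morphim_der ?N_branch //.
apply: (@mem_morphim _ _ _ (sec_at_morphism n.+1 i)) => //.
by apply: (subsetP (N_branch i)); apply: (subsetP (der_sub 1 N)).
Qed.

Let secNM s t i : s \in N -> t \in N -> sec (s * t) i = sec s i * sec t i.
Proof. by move=> /NP[sG s1] /NP[tG t1]; rewrite secM ?GT // s1 perm1. Qed.

Let secNV s i : s \in N -> sec s^-1 i = (sec s i)^-1.
Proof. by move=> /NP[sG s1]; rewrite secV ?GT // s1 invg1 perm1. Qed.

(** Otherwise the sign at i of an element of N would only depend on its section at
    j, hence be trivial whenever the sign at j is, since E has only one nontrivial
    sign.  Starting from an element odd at one branch, all three signs would be
    odd, contradicting their product. *)
Lemma separate_some : exists i j, i != j /\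
  exists2 k, k \in N & sec k j = 1 /\ top_sgn (sec k i).
Proof.
pose P (p : 'I_3 * 'I_3) := (p.1 != p.2) &&
  [exists k in N, (sec k p.2 == 1) && top_sgn (sec k p.1)].
have [[i j] /andP[ij /existsP[k /and3P[kN /eqP kj ki]]]|noP] := pickP P.
  by exists i, j; split=> //; exists k.
have imp i j s : i != j -> s \in N -> top_sgn (sec s j) = false -> top_sgn (sec s i) = false.
  move=> ij sN sj.
  have : sec s j \in E^`(1) by rewrite der_E2 in_set NE //= sj.
  rewrite -(N_full j) -morphim_der ?N_branch // => /morphimP[t _ tN tE]; rewrite /= /sec_at in tE.
  have tN' := subsetP (der_sub _ _) _ tN.
  rewrite -(mulgKV t s) secNM ?groupM ?groupV //.
  rewrite top_sgnM ?NE ?groupM ?groupV // (sec_derN i tN) addbF.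
  have /negbT := noP (i, j); rewrite /P /= ij /= => /existsPn/(_ (s * t^-1)).
  rewrite groupM ?groupV //= negb_and => /orP[/eqP[]|/negbTE //].
  by rewrite (secNM _ sN (groupVr tN')) (secNV _ tN') -tE mulgV.
have [s sN s0] := branch_odd 0%R.
have odd_all i : top_sgn (sec s i).
  have [-> //|i0] := eqVneq i 0%R; apply: contraTT s0 => /negbTE si.
  by rewrite (imp 0%R i s) // eq_sym.
have [sG s1] := NP _ sN.
have := sg_E2 (subsetP GW _ sG); rewrite (@addb_sum3 _ 0%R 1%R 2%R) //= !odd_all.
by rewrite /top_sgn s1 odd_perm1.
Qed.

Lemma separate i j : i != j -> exists2 k, k \in N & sec k j = 1 /\ top_sgn (sec k i).
Proof.
move=> ij; have [i0 [j0 [ij0 [k kN [kj ki]]]]] := separate_some.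
(* The permutation a takes i0 to i and j0 to j. *)
pose a := tperm i0 i * tperm (tperm i0 i j0) j.
have ai : a i0 = i.
  rewrite /a permM tpermL tpermD //; last by rewrite eq_sym.
  by apply: contraNneq ij0 => /(canRL (tpermK _ _)); rewrite tpermR => ->.
have aj : a j0 = j by rewrite /a permM tpermL.
have [g gG ga] := onto a.
have kgN : k ^ g \in N by rewrite memJ_norm // (subsetP (normal_norm NN)).
have kG := subsetP NG _ kN; have [_ k1] := NP _ kN.
have cE l : sec (k ^ g) (a l) = (sec k l) ^ (sec g l).
  rewrite conjgE secM ?groupM ?groupV ?GT // secV ?GT // topV ?GT // ga permK.
  by rewrite secM ?GT // k1 perm1 -conjgE.
exists (k ^ g) => //; split; first by rewrite -aj cE kj conj1g.
have gE : sec g i0 \in E by apply: sec_E2; apply: (subsetP GW).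
have kE := NE i0 kN; have gkE := groupM kE gE; have gVE := groupVr gE.
by rewrite -ai cE conjgE (top_sgnM gVE gkE) (top_sgnM kE gE) (top_sgnV gE) addbCA addbb addbF.
Qed.

Let Nj j := [set s in N | sec s j == 1].
Let NjE j s : (s \in Nj j) = (s \in N) && (sec s j == 1).
Proof. by rewrite in_set. Qed.
Let Nj_group_set j : group_set (Nj j).
Proof.
apply/group_setP; split=> [|s t].
  by rewrite NjE group1; apply/eqP/(morph1 (sec_at_morphism n.+1 j)).
rewrite !NjE => /andP[sN /eqP sj] /andP[tN /eqP tj].
by rewrite groupM //= (secNM _ sN tN) sj tj mulg1.
Qed.

(** Upgrade of [separate]: a normal subgroup of E containing an odd element is E. *)
Lemma separate_full i j c : i != j -> c \in E -> exists2 s, s \in N & sec s j = 1 /\ sec s i = c.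
Proof.
move=> ij cE; pose M := Group (Nj_group_set j).
have MN : M \subset N by apply/subsetP => s; rewrite NjE => /andP[].
have nM : M <| N.
  apply/andP; split=> //; apply/subsetP => s sN; rewrite inE; apply/subsetP => _ /imsetP[t tM ->].
  move: tM; rewrite NjE => /andP[tN /eqP tj].
  rewrite NjE groupJ //= conjgE (secNM _ (groupVr sN) (groupM tN sN)) (secNM _ tN sN).
  by rewrite tj mul1g (secNV _ sN) mulVg.
have full : @sec_at 3 n.+1 i @* M = E.
  apply: normal_odd_full; first by rewrite -(N_full i) morphim_normal.
  have [k kN [kj ki]] := separate ij; exists (sec k i) => //.
  apply: (@mem_morphim _ _ _ (sec_at_morphism n.+1 i)); first exact: (subsetP (N_branch i)).
  by rewrite NjE kN kj eqxx.
have := cE; rewrite -full => /morphimP[s _]; rewrite NjE => /andP[sN /eqP sj] ->.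
by exists s.
Qed.

(** Commutators of elements of N that are trivial on two different branches yield
    every even element supported on the third one. *)
Lemma generate_step : G = W :> {set _}.
Proof.
have h1 i c : c \in even_part n -> at_branch i c \in G.
  rewrite -der_E2; suff: E^`(1) \subset at_branch i @*^-1 G.
    by move=> sub /(subsetP sub); rewrite inE => /andP[_]; rewrite inE.
  rewrite gen_subG; apply/subsetP => _ /imset2P[x y xE yE ->].
  have [j [ji _]] := ord3_other i i; rewrite eq_sym in ji.
  have [l [li lj]] := ord3_other i j; have il : i != l by rewrite eq_sym.
  have [s sN [sj si]] := separate_full ji xE.
  have [t tN [tl ti]] := separate_full il yE.
  have [[sG s1] [tG t1]] := (NP _ sN, NP _ tN).
  rewrite 2!inE -si -ti /= inE.
  by rewrite -(commutator_at_branch (subsetP GW _ sG) (subsetP GW _ tG) s1 t1 ji li lj sj tl) groupR.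
have h2 i : exists2 s, s \in G & top s = 1 /\ forall j, top_sgn (sec s j) = (j != i).
  have [j [ji _]] := ord3_other i i.
  have [k kN [ki kj]] := separate ji; have [kG k1] := NP _ kN.
  exists k => //; split=> // m; have [->|mi] := eqVneq m i; first by rewrite ki top_sgn1.
  have [->|mj] := eqVneq m j; first by rewrite kj.
  have := sg_E2 (subsetP GW _ kG); rewrite (addb_sum3 _ ji mj mi) /= ki kj top_sgn1.
  by rewrite {1}/top_sgn k1 odd_perm1; case: top_sgn.
apply/eqP; rewrite eqEsubset GW; apply/subsetP => w wW.
have [g gG gw] := onto (top w); have gW := subsetP GW _ gG.
rewrite -(groupMr _ (groupVr gG)); apply: (kernel_generated GW h1 h2).
  by rewrite groupM ?groupV.
by rewrite topM ?E2_tree ?groupV // topV ?E2_tree // gw mulgV.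
Qed.
End GenerateStep.

(** The conditions pass to the group induced on a branch by the stabilizer of that
    branch, which is what makes the induction work. *)
Theorem E2_generated n (G : {group {perm vertex 3 n.+1}}) : G \subset E2 3 n.+1 ->
  level_transitive G -> odd_at_vertex G -> odd_at_edge G -> G = E2 3 n.+1 :> {set _}.
Proof.
elim: n G => [|n IH] G GE T S1 S2;
  have GT := subset_trans GE (E2_sub_tree _ _); have onto := top_full GT T S1.
  apply/eqP; rewrite eqEsubset GE; apply/subsetP => s sT.
  have [g gG gs] := onto (top s); rewrite (_ : s = g) //.
  apply: tree_eq => // [|i]; first exact: (subsetP GT).
  by rewrite [LHS]vertex0_perm [RHS]vertex0_perm.
apply: generate_step => // [i|i]; last first.
  have [g gG [gi o]] := S2 [::] i isT; have gT := subsetP GT _ gG.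
  exists g => //; move: gi o; rewrite /= ap_sec // ap_nil ?sec_tree //.
  by move=> [gi]; rewrite loc_sec //.
have sub s : s \in G -> top s i = i -> sec s i \in @sec_at 3 n.+1 i @* (G :&: fix_branch n.+1 i).
  move=> sG si; have sB : s \in fix_branch n.+1 i by rewrite fix_branchE (subsetP GT) //= si.
  by apply: (@mem_morphim _ _ _ (sec_at_morphism n.+1 i)) => //; rewrite inE sG.
apply: (IH (sec_at i @* (G :&: fix_branch n.+1 i))%G) => /= [|u v uv un|u un|u j un].
- apply/subsetP => _ /morphimP[s _ /setIP[sG _] ->].
  by apply: sec_E2; apply: (subsetP GE).
- have [g gG] := T (i :: u) (i :: v) (congr1 S uv) un.
  rewrite ap_sec ?(subsetP GT) // => -[gi gu].
  by exists (sec g i) => //; apply: sub.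
- have [g gG []] := S1 (i :: u) un.
  rewrite ap_sec ?(subsetP GT) ?(ltnW un) // => -[gi gu]; rewrite loc_sec ?(subsetP GT) // => o.
  by exists (sec g i) => //; apply: sub.
have un2 : size (rcons u j) < n.+1 by rewrite size_rcons.
have un1 : size u < n.+1 by apply: ltnW.
have [g gG []] := S2 (i :: u) j un; have gT := subsetP GT _ gG.
rewrite rcons_cons (ap_sec _ gT (ltnW un2)) => -[gi gu].
rewrite (loc_sec _ gT un1) (loc_sec _ gT un2) => o.
by exists (sec g i) => //; apply: sub.
Qed.

Local Close Scope group_scope.
Import Order.TTheory Num.Theory.
Local Open Scope ring_scope.

(** * Polynomials over a discretely valued field *)

Section Valuation.
Variables (K : fieldType) (v : K -> int).
Hypothesis vM : forall x y, x != 0 -> y != 0 -> v (x * y) = v x + v y.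
Hypothesis vD : forall x y, x != 0 -> y != 0 -> x + y != 0 -> Num.min (v x) (v y) <= v (x + y).

(** The condition that the valuation is at least m, with the value at 0 treated as
    infinite. *)
Definition vge (m : int) (x : K) := (x == 0) || (m <= v x).

Lemma val1 : v 1 = 0.
Proof.
have h : v (1 * 1) = v 1 + v 1 by apply: vM; apply: oner_neq0.
by rewrite mulr1 in h; lia.
Qed.

Lemma valN1 : v (-1) = 0.
Proof.
have n1 : -1 != 0 :> K by rewrite oppr_eq0 oner_neq0.
have h : v (-1 * -1) = v (-1) + v (-1) by apply: vM.
by rewrite mulrNN mulr1 val1 in h; lia.
Qed.

Lemma valV x : x != 0 -> v x^-1 = - v x.
Proof.
move=> x0; have h : v (x * x^-1) = v x + v x^-1 by apply: vM; rewrite ?invr_neq0.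
by rewrite divff // val1 in h; lia.
Qed.

Lemma vge0 m : vge m 0. Proof. by rewrite /vge eqxx. Qed.

Lemma vge_mono m m' x : m' <= m -> vge m x -> vge m' x.
Proof. by move=> mm /orP[x0|mx]; rewrite /vge ?x0 // (le_trans mm mx) orbT. Qed.

Lemma vgeM m m' x y : vge m x -> vge m' y -> vge (m + m') (x * y).
Proof.
rewrite /vge mulf_eq0; have [//|x0] := eqVneq x 0; have [//|y0] := eqVneq y 0.
by rewrite /= vM //; apply: lerD.
Qed.

Lemma vgeD m x y : vge m x -> vge m y -> vge m (x + y).
Proof.
have [->|x0] := eqVneq x 0; first by rewrite add0r.
have [->|y0] := eqVneq y 0; first by rewrite addr0.
rewrite /vge (negbTE x0) (negbTE y0) /=; have [//|xy0] := eqVneq (x + y) 0.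
move=> mx my /=; apply: le_trans (vD x0 y0 xy0); by rewrite le_min mx my.
Qed.

Lemma vgeN m x : vge m (- x) = vge m x.
Proof.
rewrite /vge oppr_eq0; have [//|x0] := eqVneq x 0.
by rewrite -mulN1r vM ?oppr_eq0 ?oner_neq0 // valN1 add0r.
Qed.

Lemma vgeB m x y : vge m x -> vge m y -> vge m (x - y).
Proof. by move=> mx my; apply: vgeD; rewrite ?vgeN. Qed.

Lemma vge_sum m I (r : seq I) (P : pred I) F : (forall i, P i -> vge m (F i)) -> vge m (\sum_(i <- r | P i) F i).
Proof. by move=> h; elim/big_ind: _ => //; [apply: vge0 | apply: vgeD]. Qed.

Definition vunit x := vge 0 x && ~~ vge 1 x.

Lemma vunitE x : vunit x = (x != 0) && (v x == 0).
Proof.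
rewrite /vunit /vge; have [//|x0] /= := eqVneq x 0.
by apply/andP/eqP; lia.
Qed.

Lemma vunitM x y : vunit x -> vunit y -> vunit (x * y).
Proof.
rewrite !vunitE => /andP[x0 /eqP vx] /andP[y0 /eqP vy].
by rewrite mulf_neq0 //= vM // vx vy.
Qed.

Lemma vunitX x n : vunit x -> vunit (x ^+ n).
Proof.
move=> ux; elim: n => [|n IH]; last by rewrite exprS; apply: vunitM.
by rewrite expr0 vunitE oner_neq0 val1.
Qed.

Lemma vunitD x y : vunit x -> vge 1 y -> vunit (x + y).
Proof.
move=> /andP[x0 x1] y1; apply/andP; split.
  by apply: vgeD => //; apply: vge_mono y1.
by apply: contraNN x1 => xy; rewrite -(addrK y x); apply: vgeB.
Qed.

Definition integral_poly (p : {poly K}) := forall i, vge 0 p`_i.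

Lemma integral_polyD p q : integral_poly p -> integral_poly q -> integral_poly (p + q).
Proof. by move=> hp hq i; rewrite coefD; apply: vgeD. Qed.
Lemma integral_polyN p : integral_poly p -> integral_poly (- p).
Proof. by move=> hp i; rewrite coefN vgeN. Qed.
Lemma integral_polyM p q : integral_poly p -> integral_poly q -> integral_poly (p * q).
Proof.
move=> hp hq i; rewrite coefM; apply: vge_sum => j _.
by rewrite -[0]addr0; apply: vgeM.
Qed.
Lemma vge01 : vge 0 1. Proof. by rewrite /vge val1 lexx orbT. Qed.
Lemma integral_polyC c : vge 0 c -> integral_poly c%:P.
Proof. by move=> hc i; rewrite coefC; case: eqP => // _; apply: vge0. Qed.
Lemma integral_polyXn n : integral_poly 'X^n.
Proof. by move=> i; rewrite coefXn; case: eqP => _; [apply: vge01 | apply: vge0]. Qed.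
Lemma integral_polyX : integral_poly 'X. Proof. by have := integral_polyXn 1; rewrite expr1. Qed.
Lemma integral_poly_exp p n : integral_poly p -> integral_poly (p ^+ n).
Proof.
move=> hp; elim: n => [|n IH]; last by rewrite exprS; apply: integral_polyM.
by rewrite expr0 -[1]/(1%:P); apply: integral_polyC; apply: vge01.
Qed.
Lemma integral_polyZ c p : vge 0 c -> integral_poly p -> integral_poly (c *: p).
Proof. by move=> hc hp; rewrite -mul_polyC; apply: integral_polyM => //; apply: integral_polyC. Qed.

(** The reduction of p modulo the maximal ideal is defined and nonzero, with
    lowest term in degree i. *)
Definition lowest_unit p i := [/\ integral_poly p, vunit p`_i & forall j, (j < i)%N -> vge 1 p`_j].

(** Gauss's lemma. *)
Lemma lowest_unitM p q i j : lowest_unit p i -> lowest_unit q j -> lowest_unit (p * q) (i + j).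
Proof.
move=> [hp pi pl] [hq qj ql]; split; first exact: integral_polyM.
  have lt : (i < (i + j).+1)%N by rewrite ltnS leq_addr.
  rewrite coefM (bigD1 (Ordinal lt)) //= addKn.
  apply: vunitD; first exact: vunitM.
  apply: vge_sum => k; rewrite -val_eqE /= => ki.
  have [lki|] := ltnP k i.
    by rewrite -[1]addr0; apply: vgeM => //; apply: pl.
  rewrite leq_eqVlt eq_sym (negbTE ki) /= => ik.
  by rewrite -[1]add0r; apply: vgeM => //; apply: ql; have := ltn_ord k; lia.
move=> k kij; rewrite coefM; apply: vge_sum => l _.
have [li|il] := ltnP l i.
  by rewrite -[1]addr0; apply: vgeM => //; apply: pl.
by rewrite -[1]add0r; apply: vgeM => //; apply: ql; have := ltn_ord l; lia.
Qed.

Lemma lowest_unit_inj p i j : lowest_unit p i -> lowest_unit p j -> i = j.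
Proof.
move=> [_ /andP[_ ui] li] [_ /andP[_ uj] lj]; apply/eqP; rewrite eqn_leq.
apply/andP; split; rewrite leqNgt; apply/negP.
  by move/li; apply/negP.
by move/lj; apply/negP.
Qed.

Lemma lowest_unit_size p i : lowest_unit p i -> (i < size p)%N.
Proof.
move=> [_ /andP[_ u] _]; rewrite ltnNge; apply/negP => /(nth_default 0) E.
by rewrite E vge0 in u.
Qed.

(** Divide by a coefficient of smallest valuation. *)
Lemma lowest_unit_exists p : p != 0 -> exists2 t, t != 0 & exists i, lowest_unit (t *: p) i.
Proof.
move=> p0.
have lt : ((size p).-1 < size p)%N by rewrite ltn_predL lt0n size_poly_eq0.
have P0 : p`_(Ordinal lt) != 0 by rewrite /= -lead_coefE lead_coef_eq0.
case: (@arg_minP _ _ _ (Ordinal lt) (fun i : 'I_(size p) => p`_i != 0)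
         (fun i => v p`_i) P0) => k pk mk.
pose t := (p`_k)^-1.
have t0 : t != 0 by rewrite invr_neq0.
have tp : integral_poly (t *: p).
  move=> j; rewrite coefZ /vge; have [->|pj] := eqVneq p`_j 0; first by rewrite mulr0 eqxx.
  have js : (j < size p)%N by rewrite ltnNge; apply/negP => /(nth_default 0) E; rewrite E eqxx in pj.
  by rewrite vM // valV //; have := mk (Ordinal js) pj; rewrite /=; lia.
exists t => //.
have exu : exists i, vunit (t *: p)`_i.
  by exists k; rewrite coefZ vunitE mulf_neq0 //= mulVf // val1.
exists (ex_minn exu); case: ex_minnP => i ui mi; split=> // j ji.
apply/negPn/negP => nj; have /mi : vunit (t *: p)`_j by rewrite /vunit nj tp.
by rewrite leqNgt ji.
Qed.

Lemma lowest_unit_scale p i c : lowest_unit p i -> (exists j, lowest_unit (c *: p) j) -> vunit c.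
Proof.
move=> [hp up lp] [j [hc ucj _]].
have c0 : c != 0 by apply: contraTneq ucj => ->; rewrite scale0r coef0 /vunit !vge0.
rewrite vunitE c0 /=.
have := hc i; rewrite coefZ /vge mulf_eq0 (negbTE c0) /=.
move: up; rewrite vunitE => /andP[pi0 /eqP vi]; rewrite (negbTE pi0) /= vM // vi => h.
suff : ~~ (1 <= v c) by lia.
apply/negP => c1; move: ucj; rewrite coefZ => /andP[_ /negP]; apply.
by rewrite -[1]addr0; apply: vgeM; rewrite // /vge c1 orbT.
Qed.

(** Eisenstein's criterion.  For a factorization of F into polynomials with nonzero
    reductions, the reductions are monomials; if both degrees are positive, both
    constant terms are in the maximal ideal and F(0) is in its square. *)
Lemma eisenstein (F : {poly K}) N : (0 < N)%N -> size F = N.+1 -> lowest_unit F N -> ~~ vge 2 F`_0 ->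
  irreducible_poly F.
Proof.
move=> N0 sF lF F0; split; first by rewrite sF ltnS.
move=> q sq qF; have [r Fr] := dvdpP _ _ qF.
have Fn0 : F != 0 by rewrite -size_poly_eq0 sF.
have [rn0 qn0] : r != 0 /\ q != 0 by apply/norP; rewrite -mulf_eq0 -Fr.
have [t t0 [i li]] := lowest_unit_exists qn0.
have [s s0 [j lj]] := lowest_unit_exists rn0.
have lij := lowest_unitM lj li.
have E : (s *: r) * (t *: q) = (s * t) *: F.
  by rewrite -scalerAl -scalerAr scalerA -Fr.
rewrite E in lij.
have ust : vunit (s * t) by apply: lowest_unit_scale lF _; exists (j + i)%N.
have lcN : lowest_unit ((s * t) *: F) N.
  have [hp up lp] := lF; split.
  - by apply: integral_polyZ => //; case/andP: ust.
  - by rewrite coefZ; apply: vunitM.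
  by move=> k kN; rewrite coefZ -[1]add0r; apply: vgeM; [case/andP: ust | apply: lp].
have ijN := lowest_unit_inj lij lcN.
have [si sj] := (lowest_unit_size li, lowest_unit_size lj); rewrite !size_scale // in si sj.
have := sF; rewrite Fr size_mul // => sz.
have [iE jE] : size q = i.+1 /\ size r = j.+1.
  by move: si sj sz ijN; move: (size q) (size r) => a b; lia.
have [j0|j0] := posnP j.
  have /size_poly1P[c c0 ->] : size r == 1%N by rewrite jE j0.
  by rewrite mul_polyC eqp_sym eqp_scale // eqpxx.
have i0 : (0 < i)%N by rewrite lt0n; apply: contraNneq sq => i0; rewrite iE i0.
case/negP: F0.
have : vge 2 ((s * t) *: F)`_0.
  rewrite -E coef0M; have [_ _ /(_ _ i0) hi] := li; have [_ _ /(_ _ j0) hj] := lj.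
  by rewrite -[2]/(1 + 1); apply: vgeM.
rewrite coefZ /vge mulf_eq0 mulf_eq0 (negbTE s0) (negbTE t0) /=.
have [//|F00] := eqVneq F`_0 0; rewrite /= vM ?mulf_neq0 //.
by move: ust; rewrite vunitE => /andP[_ /eqP ->]; rewrite add0r.
Qed.

(** By Gauss's lemma the cofactor c is integral, so b(0) = F(0) c(0) lies in the
    maximal ideal. *)
Lemma multiple_coef0 F e c b : lowest_unit F e -> vge 1 F`_0 -> integral_poly b -> F * c = b ->
  vge 1 b`_0.
Proof.
move=> lF F0 hb E.
have [c0|cn0] := eqVneq c 0; first by rewrite -E c0 mulr0 coef0 vge0.
have [t t0 [i li]] := lowest_unit_exists cn0.
have lFc := lowest_unitM lF li.
(* The cofactor c has no denominators: otherwise t would have positive valuation,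
   but the reduction of F * (t *: c) is nonzero. *)
have Et : F * (t *: c) = t *: b by rewrite -scalerAr E.
have vt : v t <= 0.
  rewrite leNgt; apply/negP => vt; have [_ /andP[_ /negP u] _] := lFc; apply: u.
  by rewrite Et coefZ -[1]addr0; apply: vgeM => //; rewrite /vge; apply/orP; right; lia.
rewrite -E coef0M -[1]addr0; apply: vgeM => //.
have -> : c`_0 = t^-1 * (t *: c)`_0 by rewrite coefZ mulKf.
have [hc _ _] := li.
rewrite -[0]addr0; apply: vgeM => //.
by rewrite /vge valV //; apply/orP; right; lia.
Qed.

(** Here w is a root of F = W^e U - pi, with pi a uniformizer and U(0) a unit.  The
    ring of integral polynomials in w, localized at w, is a discrete valuation
    ring with uniformizer w, as its quotient by w is the residue field of v.  The
    lemmas use only the fragment of this that is needed to see that an odd power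
    of w times a unit is not a square. *)
Section NonSquare.
Variables (L : fieldType) (phi : {rmorphism K -> L}) (w : L) (pi : K) (e : nat) (U F : {poly K}).
Hypothesis vpi : v pi = 1.
Hypothesis pi0 : pi != 0.
Hypothesis e0 : (0 < e)%N.
Hypothesis UO : integral_poly U.
Hypothesis U0 : vunit U`_0.
Hypothesis FE : F = 'X^e * U - pi%:P.
Local Notation ev g := (map_poly phi g).[w].
Hypothesis Fw : forall g : {poly K}, ev g = 0 -> F %| g.
Hypothesis F0 : ev F = 0.

Let lowF : lowest_unit F e.
Proof.
have hpi : vge 1 pi by rewrite /vge vpi lexx orbT.
split.
- rewrite FE; apply: integral_polyD; first by apply: integral_polyM => //; apply: integral_polyXn.
  by apply: integral_polyN; apply: integral_polyC; apply: vge_mono hpi.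
- rewrite FE coefB coefXnM ltnn subnn coefC.
  by rewrite eqn0Ngt e0 subr0.
move=> j je; rewrite FE coefB coefXnM je coefC sub0r vgeN.
by case: eqP => // _; apply: vge0.
Qed.

Let F0' : vge 1 F`_0.
Proof. by have [_ _] := lowF; apply. Qed.

Let evD g h : ev (g + h) = ev g + ev h. Proof. by rewrite rmorphD hornerD. Qed.
Let evN g : ev (- g) = - ev g. Proof. by rewrite rmorphN hornerN. Qed.
Let evM g h : ev (g * h) = ev g * ev h. Proof. by rewrite rmorphM hornerM. Qed.
Let evX : ev 'X = w. Proof. by rewrite map_polyX hornerX. Qed.
Let evXn n : ev 'X^n = w ^+ n. Proof. by rewrite map_polyXn hornerXn. Qed.
Let evC c : ev c%:P = phi c. Proof. by rewrite map_polyC hornerC. Qed.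

Let phi_pi : phi pi = w ^+ e * ev U.
Proof. by move/eqP: F0; rewrite FE evD evN evM evXn evC subr_eq0 => /eqP. Qed.

Let vanish g : integral_poly g -> ev g = 0 -> vge 1 g`_0.
Proof.
move=> hg /Fw/dvdpP[c gE]; apply: (multiple_coef0 lowF F0' hg (c := c)).
by rewrite gE mulrC.
Qed.

Let w0 : w != 0.
Proof.
apply: contraTneq pi0 => w0; move/eqP: phi_pi.
by rewrite w0 expr0n eqn0Ngt e0 mul0r fmorph_eq0 => ->.
Qed.

Let evZ c g : ev (c *: g) = phi c * ev g.
Proof. by rewrite -mul_polyC evM evC. Qed.

Let evE g n : ev (g ^+ n) = ev g ^+ n.
Proof. by rewrite rmorphXn /= horner_exp. Qed.

Let not_vge1 x : vunit x -> ~ vge 1 x.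
Proof. by case/andP => _ /negP. Qed.

(** If w divides the square of an element g(w), then g(0) is in the maximal ideal,
    hence a multiple of pi, which is itself a multiple of w. *)
Lemma root_descent N g t : integral_poly g -> integral_poly t -> ev g ^+ 2 = w ^+ N.+1 * ev t ->
  exists2 g', integral_poly g' & ev g = w * ev g'.
Proof.
move=> hg ht E.
have g0 : vge 1 g`_0.
  apply: contraT => ng; have ug : vunit g`_0 by rewrite /vunit hg.
  have hz : ev (g * g - 'X * ('X^N * t)) = 0.
    by rewrite evD evN !evM evXn evX mulrA -exprS -E expr2 subrr.
  case: (not_vge1 (vunitM ug ug)); rewrite -coef0M.
  have -> : (g * g)`_0 = (g * g - 'X * ('X^N * t))`_0.
    by rewrite coefB [X in _ = _ - X]coefXM subr0.
  apply: vanish => //; apply: integral_polyD; first exact: integral_polyM.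
  by apply: integral_polyN; apply: integral_polyM; [apply: integral_polyX | apply: integral_polyM => //; apply: integral_polyXn].
(* The constant term c * pi is replaced by c * w^e * U(w). *)
pose c := g`_0 / pi.
have c0 : vge 0 c.
  by apply: (@vgeM 1 (-1)) => //; rewrite /vge valV // vpi lexx orbT.
exists (drop_poly 1 g + c *: ('X^(e.-1) * U)).
  apply: integral_polyD => [i|]; first by rewrite coef_drop_poly.
  by apply: integral_polyZ => //; apply: integral_polyM => //; apply: integral_polyXn.
have tk : take_poly 1 g = (g`_0)%:P.
  by apply/polyP => i; rewrite coef_take_poly coefC; case: i.
rewrite -{1}(poly_take_drop 1 g) tk evD evM evC evXn expr1 evD evZ evM evXn.
have -> : g`_0 = c * pi by rewrite divfK.
by rewrite rmorphM /= phi_pi -{1}(prednK e0) exprS; ring.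
Qed.

Lemma nonsquare_integral N g t : integral_poly g -> integral_poly t -> vunit t`_0 ->
  ev g ^+ 2 = w ^+ N.*2.+1 * ev t -> False.
Proof.
elim: N g => [|N IH] g hg ht ut E; have [g' hg' gE] := root_descent hg ht E.
  have hz : ev ('X * g' ^+ 2 - t) = 0.
    apply: (mulfI w0); rewrite mulr0 evD evN evM evX evE.
    by move: E; rewrite gE expr1 => E; rewrite mulrBr -E; ring.
  apply: (not_vge1 ut); rewrite -vgeN.
  have -> : - t`_0 = ('X * g' ^+ 2 - t)`_0 by rewrite coefB coefXM sub0r.
  apply: vanish => //; apply: integral_polyD; last exact: integral_polyN.
  by apply: integral_polyM; [apply: integral_polyX | apply: integral_poly_exp].
apply: (IH g') => //; apply: (mulfI (expf_neq0 2 w0)).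
by rewrite -exprMn -gE E doubleS mulrA -exprD.
Qed.

Lemma nonsquare m h s : integral_poly s -> vunit s`_0 -> ev h ^+ 2 = w ^+ m.*2.+1 * ev s -> False.
Proof.
move=> hs us E; have [h0|hn0] := eqVneq h 0.
  move/eqP: E; rewrite h0 rmorph0 horner0 expr0n /= eq_sym mulf_eq0 expf_eq0 (negbTE w0) /=.
  by move/eqP/(vanish hs); apply: not_vge1.
have [t t0 [i [hi _ _]]] := lowest_unit_exists hn0.
(* Multiplying h by pi^j makes it integral and keeps the parity of the exponent
   of w. *)
pose j := `|v t|%N.
have vpij : v (pi ^+ j) = j%:Z.
  elim: (j) => [|k IH]; first by rewrite expr0 val1.
  by rewrite exprS vM ?expf_neq0 // IH vpi; lia.
apply: (@nonsquare_integral (e * j + m) ((pi ^+ j) *: h) (U ^+ j.*2 * s)).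
- have -> : pi ^+ j *: h = (pi ^+ j / t) *: (t *: h) by rewrite scalerA divfK.
  apply: integral_polyZ => //; rewrite /vge; apply/orP; right.
  by rewrite vM ?expf_neq0 ?invr_neq0 // valV // vpij; lia.
- by apply: integral_polyM => //; apply: integral_poly_exp.
- by rewrite coef0M; apply: vunitM => //; rewrite -horner_coef0 horner_exp horner_coef0; apply: vunitX.
rewrite evZ exprMn E rmorphXn /= phi_pi evM evE.
have -> : ((e * j + m).*2.+1 = e * j * 2 + m.*2.+1)%N by lia.
rewrite -(muln2 j) exprD !exprM exprMn.
move: (w ^+ m.*2.+1) (ev s) (ev U) => x y z; rewrite ?exprMn; ring.
Qed.
End NonSquare.
End Valuation.

(** * Expansion of the iterates at the critical points *)

(** The coefficient of W^2 in f(eps + W). *)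
Definition slope (eps : bool) : int := if eps then 3 else - 3.

(** The polynomial g_k with f^k(eps + W) = c + g_k(W), where c is the image of the
    critical point eps under f^k. *)
Fixpoint increment (eps : bool) (k : nat) : {poly int} :=
  if k is k'.+1 then
    let g := increment eps k' in g ^+ 2 * (2 *: g + (slope (eps (+) odd k'))%:P)
  else 'X.

Lemma fpoly_comp (K : fieldType) (p : {poly K}) :
  fpoly K \Po p = 2 * p ^+ 3 - 3 * p ^+ 2 + 1.
Proof.
rewrite /fpoly comp_polyD comp_polyB !comp_polyZ !comp_Xn_poly rmorph1.
by rewrite -!mul_polyC !(rmorph_nat (polyC : {rmorphism K -> {poly K}})).
Qed.

Lemma fpoly_comp_at (K : fieldType) (eps : bool) (g : {poly K}) :
  fpoly K \Po (eps%:R + g) = (~~ eps)%:R + g ^+ 2 * (2 * g + (slope eps)%:~R).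
Proof. by rewrite fpoly_comp; case: eps; rewrite /= ?rmorphN /=; ring. Qed.

Lemma iter_polyS (K : fieldType) (f : {poly K}) n :
  iter_poly f n.+1 = f \Po iter_poly f n.
Proof. by []. Qed.

Lemma iter_poly_shift (K : fieldType) (eps : bool) k :
  iter_poly (fpoly K) k \Po ('X + eps%:R%:P) =
  (eps (+) odd k)%:R + map_poly intr (increment eps k).
Proof.
elim: k => [|k IH].
  by rewrite /= comp_polyX map_polyX addbF rmorph_nat addrC.
rewrite iter_polyS -comp_polyA IH fpoly_comp_at /= addbN; congr (_ + _).
rewrite rmorphM rmorphXn rmorphD /= map_polyZ map_polyC /= -mul_polyC.
by rewrite rmorph_nat rmorph_int.
Qed.

Lemma increment_2adic eps k : exists2 U : {poly int},
  increment eps k = 'X^(2 ^ k) * U & odd (absz U`_0).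
Proof.
elim: k => [|k [U gE oU]]; first by exists 1; rewrite ?coef1 // mulr1 expr1.
exists (U ^+ 2 * (2 *: increment eps k + (slope (eps (+) odd k))%:P)).
  by rewrite /= gE exprMn -exprM expnSr; ring.
rewrite coef0M -horner_coef0 horner_exp horner_coef0 coefD coefZ coefC /=.
have -> : (increment eps k)`_0 = 0 by rewrite gE coefXnM expn_gt0.
rewrite mulr0 add0r abszM oddM abszX oddX /= oU.
by case: (eps (+) odd k).
Qed.

Lemma increment_coef0 eps k : (increment eps k)`_0 = 0.
Proof. by have [U -> _] := increment_2adic eps k; rewrite coefXnM expn_gt0. Qed.

Lemma increment_3adic eps k : exists l h,
  increment eps k = l *: 'X^(3 ^ k) + 3 *: h /\ ~~ (3 %| l)%Z.
Proof.
elim: k => [|k [l [h [gE l3]]]]; first by exists 1, 0; rewrite scaler0 addr0 scale1r.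
pose c : int := if eps (+) odd k then 1 else -1.
pose a : {poly int} := l *: 'X^(3 ^ k).
exists (2 * l ^+ 3), (2 * (3 * a ^+ 2 * h + 9 * a * h ^+ 2 + 9 * h ^+ 3) + c%:P * (increment eps k) ^+ 2).
split; last first.
  by rewrite dvdzE in l3; rewrite dvdzE !abszM !Euclid_dvdM // !(negbTE l3).
rewrite [LHS]/= gE -/a.
have -> : (2 * l ^+ 3) *: 'X^(3 ^ k.+1) = 2 * a ^+ 3.
  by rewrite /a exprZn -exprM -expnSr -!mul_polyC polyCM rmorph_nat mulrA.
have -> : (slope (eps (+) odd k))%:P = 3 * c%:P :> {poly int}.
  by rewrite /c; case: (_ (+) _); rewrite /slope ?polyCN ?rmorph_nat; ring.
by rewrite -!mul_polyC !rmorph_nat; ring.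
Qed.

Section Sizes.
Variable F : fieldType.
Hypothesis two0 : 2 != 0 :> F.

Lemma size_fpoly : size (fpoly F) = 4.
Proof.
have s3 : size (2 *: 'X^3 : {poly F}) = 4 by rewrite size_scale // size_polyXn.
have s2 : (size (- (3 *: 'X^2) : {poly F}) <= 3)%N.
  by rewrite size_polyN (leq_trans (size_scale_leq _ _)) // size_polyXn.
rewrite /fpoly -addrA size_polyDl s3 // (leq_ltn_trans (size_polyD _ _)) //.
by rewrite size_poly1 gtn_max /= ltnS s2.
Qed.

Lemma size_iter_poly k : size (iter_poly (fpoly F) k) = (3 ^ k)%N.+1.
Proof.
have h : (size (iter_poly (fpoly F) k)).-1 = (3 ^ k)%N.
  elim: k => [|k IH]; first by rewrite size_polyX.
  by rewrite iter_polyS size_comp_poly size_fpoly IH expnS.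
by rewrite -h prednK //; case: size h => // /esym/eqP; rewrite expn_eq0.
Qed.

Lemma size_iter_sub k a : size (iter_poly (fpoly F) k - a%:P) = (3 ^ k)%N.+1.
Proof.
rewrite size_polyDl size_iter_poly // size_polyN (leq_ltn_trans (size_polyC_leq1 _)) //.
by rewrite ltnS expn_gt0.
Qed.
End Sizes.

(** * Irreducibility and nonsquareness over a number field *)

Lemma irreducible_shift (F : fieldType) (p : {poly F}) c :
  irreducible_poly (p \Po ('X + c%:P)) -> irreducible_poly p.
Proof.
have sX : size ('X + c%:P) = 2 by rewrite size_XaddC.
move=> [sp ip]; split=> [|q sq qp]; first by rewrite size_comp_poly2 in sp.
have := ip (q \Po ('X + c%:P)); rewrite size_comp_poly2 // => /(_ sq (dvdp_comp_poly _ qp)).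
by move/eqp_size; rewrite !size_comp_poly2 // -dvdp_size_eqp // => ->.
Qed.

Section CharZero.
Variable K : fieldExtType rat.

Lemma intr_eq0K (m : int) : (m%:~R == 0 :> K) = (m == 0).
Proof.
have -> : m%:~R = in_alg K m%:~R by rewrite rmorph_int.
by rewrite fmorph_eq0 intr_eq0.
Qed.

Lemma natr_eq0K (m : nat) : (m%:R == 0 :> K) = (m == 0%N).
Proof. by rewrite -[m%:R]/(m%:Z%:~R) intr_eq0K. Qed.

Lemma two_neq0 : 2 != 0 :> K.
Proof. by rewrite natr_eq0K. Qed.

Section AtPrime.
Variables (P : K -> Prop) (l : nat) (v : K -> int).
Hypothesis PP : prime_ideal P.
Hypothesis Pl : lies_above P l.
Hypothesis Pv : normalized_valuation P v.
Let vM := nvalM Pv.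
Let vD := nvalD Pv.

Lemma vge_int m : vge v 0 m%:~R.
Proof.
rewrite /vge; have [//|m0] := eqVneq (m%:~R : K) 0.
by apply: (nval_int Pv) => //; apply: integral_id.
Qed.

Lemma vge1_int m : vge v 1 m%:~R = (l %| m)%Z.
Proof.
have mi : alg_integer (m%:~R : K) by apply: integral_id.
rewrite /vge; have [m0|m0] := eqVneq (m%:~R : K) 0.
  by move/eqP: m0; rewrite intr_eq0K => /eqP ->; rewrite dvdz0.
have := nval_center Pv m0 mi; have := Pl m => h1 h2.
by rewrite /= -gtz0_ge1; apply/idP/idP => [/h2/h1|/h1/h2].
Qed.

Lemma vunit_int m : vunit v m%:~R = ~~ (l %| m)%Z.
Proof. by rewrite /vunit vge_int vge1_int. Qed.

Lemma integral_poly_int (p : {poly int}) : integral_poly v (map_poly intr p : {poly K}).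
Proof. by move=> i; rewrite coef_map; apply: vge_int. Qed.

(** The boolean d names the critical point, 0 or 1, which a approximates. *)
Lemma near_critical a : v a = 1 \/ v (1 - a) = 1 ->
  exists d : bool, v (a - d%:R) = 1 /\ a - d%:R != 0.
Proof.
have nz x : v x = 1 -> x != 0 by move=> h; apply: contra_eq_neq h => ->; rewrite (nval0 Pv).
case=> h; first by exists false; rewrite subr0; split=> //; apply: nz.
exists true; have E : a - 1 = -1 * (1 - a) by rewrite mulN1r opprB.
have h1 : v (a - 1) = 1.
  by rewrite E vM ?oppr_eq0 ?oner_neq0 ?nz // (valN1 vM) h.
by split=> //; apply: nz.
Qed.

(** The critical point eps is chosen as the one that f^k maps to the critical point
    d close to a. *)
Section Expand.
Variables (a : K) (d : bool) (k : nat).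
Hypothesis vad : v (a - d%:R) = 1.
Hypothesis ad0 : a - d%:R != 0.
Local Notation eps := (d (+) odd k).
Local Notation g := (map_poly intr (increment eps k) : {poly K}).

Lemma iter_sub_shift : (iter_poly (fpoly K) k - a%:P) \Po ('X + eps%:R%:P) = g - (a - d%:R)%:P.
Proof.
rewrite comp_polyB comp_polyC iter_poly_shift -addbA addbb addbF.
by rewrite rmorphB /= rmorph_nat opprB; ring.
Qed.

Lemma iter_irreducible : l = 3%N -> irreducible_poly (iter_poly (fpoly K) k - a%:P).
Proof.
move=> l3; apply: (@irreducible_shift _ _ eps%:R); rewrite iter_sub_shift.
have vpi : vge v 1 (a - d%:R) by rewrite /vge vad lexx orbT.
have [c [h [E c3]]] := increment_3adic eps k.
have gi i : g`_i = (if i == (3 ^ k)%N then c else 0)%:~R + 3%:~R * (h`_i)%:~R.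
  rewrite coef_map /= E coefD !coefZ coefXn rmorphD !rmorphM /=.
  by case: eqP => _; rewrite ?mulr1 ?mulr0 ?mulr0z.
have gi1 i : i != (3 ^ k)%N -> vge v 1 g`_i.
  by move=> ik; rewrite gi (negbTE ik) add0r -intrM vge1_int l3 dvdz_mulr.
have pg : integral_poly v (g - (a - d%:R)%:P).
  apply: (integral_polyD vD); first exact: integral_poly_int.
  by apply: (integral_polyN vM); apply: integral_polyC; apply: vge_mono vpi.
apply: (@eisenstein _ v vM vD _ (3 ^ k)).
- by rewrite expn_gt0.
- by rewrite -iter_sub_shift size_comp_poly2 ?size_XaddC // size_iter_sub // two_neq0.
- split=> // [|j jk].
    rewrite coefB coefC eqn0Ngt expn_gt0 subr0 gi eqxx.
    apply: (vunitD vM vD); first by rewrite vunit_int l3.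
    by rewrite -intrM vge1_int l3 dvdz_mulr.
  rewrite coefB coefC; apply: (vgeB vM vD); first by apply: gi1; rewrite ltn_eqF.
  by case: eqP => // _; apply: vge0.
rewrite coefB coefC eqxx coef_map increment_coef0 /= sub0r (vgeN vM) /vge.
by rewrite (negbTE ad0) vad.
Qed.

Variables (L : fieldType) (phi : {rmorphism K -> L}) (y : L).
Hypothesis irr : irreducible_poly (iter_poly (fpoly K) k - a%:P).
Hypothesis y_root : (map_poly phi (iter_poly (fpoly K) k - a%:P)).[y] = 0.
Hypothesis l2 : l = 2%N.

Lemma irreducible_root_dvd (f h : {poly K}) (z : L) : irreducible_poly f ->
  (map_poly phi f).[z] = 0 -> (map_poly phi h).[z] = 0 -> f %| h.
Proof.
move=> fi f0 h0; apply: contraT; rewrite -irreducible_poly_coprime //.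
rewrite -(coprimep_map phi) => /coprimep_root => /(_ z).
by rewrite /root f0 h0 eqxx => /(_ isT).
Qed.

(** [nonsquare] for the polynomial f^k(eps + W) - a, transported to the root y by
    translation. *)
Lemma iter_nonsquare m (s : {poly int}) (h : {poly K}) :
  odd (absz s`_0) ->
  (map_poly phi h).[y] ^+ 2 = (y - eps%:R) ^+ m.*2.+1 * (map_poly intr s).[y - eps%:R] -> False.
Proof.
move=> os E.
have mE (p : {poly int}) : map_poly intr p = map_poly phi (map_poly intr p).
  by rewrite -map_poly_comp; apply: eq_map_poly => c /=; rewrite rmorph_int.
have shE (p : {poly K}) : (map_poly phi (p \Po ('X + eps%:R%:P))).[y - eps%:R] = (map_poly phi p).[y].
  by rewrite map_comp_poly horner_comp rmorphD /= map_polyX map_polyC /= !hornerE rmorph_nat subrK.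
have [U gE oU] := increment_2adic eps k.
have u_odd (c : int) : odd (absz c) -> vunit v c%:~R.
  by rewrite vunit_int l2 dvdzE /= dvdn2 negbK.
have irrF : irreducible_poly (map_poly intr (increment eps k) - (a - d%:R)%:P : {poly K}).
  rewrite -iter_sub_shift.
  have := @irreducible_shift K ((iter_poly (fpoly K) k - a%:P) \Po ('X + eps%:R%:P)) (- eps%:R).
  have -> : (iter_poly (fpoly K) k - a%:P) \Po ('X + eps%:R%:P) \Po ('X + (- eps%:R)%:P)
            = iter_poly (fpoly K) k - a%:P.
    rewrite -comp_polyA [X in _ \Po X](_ : _ = 'X) ?comp_polyXr //.
    by rewrite comp_polyD comp_polyX comp_polyC -addrA -polyCD addNr addr0.
  exact.
have F0 : (map_poly phi (map_poly intr (increment eps k) - (a - d%:R)%:P)).[y - eps%:R] = 0.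
  by rewrite -iter_sub_shift shE y_root.
apply: (@nonsquare K v vM vD L phi (y - eps%:R) (a - d%:R) (2 ^ k) (map_poly intr U)
  (map_poly intr (increment eps k) - (a - d%:R)%:P) vad ad0 _ _ _ _ _ F0 m
  (h \Po ('X + eps%:R%:P)) (map_poly intr s)).
- by rewrite expn_gt0.
- exact: integral_poly_int.
- by rewrite coef_map; apply: u_odd.
- by rewrite gE rmorphM /= map_polyXn.
- by move=> p; apply: irreducible_root_dvd irrF F0.
- exact: integral_poly_int.
- by rewrite coef_map; apply: u_odd.
by rewrite shE E mE.
Qed.

Let mapE := (rmorphN, rmorphD, rmorphM, rmorphXn).
Let evalE := (hornerN, hornerD, hornerM, horner_exp, hornerX, hornerC).

(** With w = y - eps, the right-hand side is w times a polynomial in w with constant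
    term 3 or -3. *)
Lemma disc_nonsquare (h : {poly K}) : (map_poly phi h).[y] ^+ 2 = 3 * y * (1 - y) -> False.
Proof.
move=> E.
(* The numerals are abstracted, as the morphism lemmas would otherwise split them
   into sums of ones. *)
have [[c1 E1] [c3 E3]] : (exists c : int, c = 1) /\ (exists c : int, c = 3).
  by split; [exists 1 | exists 3].
apply: (@iter_nonsquare 0
  (if eps then - (c3%:P * (c1%:P + 'X)) else c3%:P * (c1%:P - 'X)) h).
  by rewrite -horner_coef0; case: eps; rewrite !evalE E1 E3.
by rewrite E expr1; case: eps; rewrite !mapE /= !map_polyX !map_polyC /= !evalE E1 E3 rmorph1 rmorph_nat; ring.
Qed.

(** As f(eps + w) differs from 1 - eps by w^2 times a unit, the right-hand side is
    w^3 times a polynomial in w with odd constant term. *)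
Lemma disc_prod_nonsquare (h : {poly K}) : let x := 2 * y ^+ 3 - 3 * y ^+ 2 + 1 in
  (map_poly phi h).[y] ^+ 2 = (3 * x * (1 - x)) * (3 * y * (1 - y)) -> False.
Proof.
move=> x E.
have [[c1 E1] [c2 E2] [c3 E3] [c9 E9]] : [/\ exists c : int, c = 1, exists c : int, c = 2,
    exists c : int, c = 3 & exists c : int, c = 9].
  by split; [exists 1 | exists 2 | exists 3 | exists 9].
pose T (c : int) : {poly int} := c2%:P * 'X + c%:P.
apply: (@iter_nonsquare 1 (if eps
  then - (c9%:P * T c3 * (c1%:P - 'X ^+ 2 * T c3) * (c1%:P + 'X))
  else - (c9%:P * T (- c3) * (c1%:P + 'X ^+ 2 * T (- c3)) * (c1%:P - 'X))) h).
  by rewrite /T -horner_coef0; case: eps; rewrite !evalE E1 E2 E3 E9.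
rewrite E /T /x; case: eps; rewrite !mapE /= !map_polyX !map_polyC /= !evalE ?mapE /= E1 E2 E3 E9 rmorph1 !rmorph_nat; ring.
Qed.
End Expand.
End AtPrime.
End CharZero.

(** * Split polynomials and the fibres of the cubic *)

Section Splits.
Variable F : fieldType.
Implicit Types p q g : {poly F}.

Definition splits p := exists rs : seq F, p %= \prod_(r <- rs) ('X - r%:P).

Lemma splits_dvd p q : q %| p -> splits p -> splits q.
Proof.
move=> qp [rs prs]; have := qp; rewrite (eqp_dvdr _ prs) => /dvdp_prod_XsubC[m qm].
by exists (mask m rs).
Qed.

Lemma splits_root p : splits p -> size p != 1 -> exists z, root p z.
Proof.
move=> [[|r rs] prs] sp.
  by rewrite (eqp_size prs) big_nil size_poly1 in sp.
by exists r; rewrite (eqp_root prs) big_cons rootM root_XsubC eqxx.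
Qed.

Lemma splits_comp p g : p != 0 -> (1 < size g)%N -> splits (p \Po g) -> splits p.
Proof.
move=> p0 sg; have [n] := ubnP (size p); elim: n => // n IH in p p0 *.
rewrite ltnS => pn sp.
have [/eqP sp1|sp1] := eqVneq (size p) 1.
  by exists [::]; rewrite big_nil -size_poly_eq1.
have [z] : exists z, root (p \Po g) z.
  apply: splits_root sp _; have := size_comp_poly p g.
  have : (0 < size p)%N by rewrite lt0n size_poly_eq0.
  move: sp1 sg; case: (size p) => [|[|a]] //; case: (size g) => [|[|b]] // _ _ _.
  by case: (size _) => [|[|]] //=.
rewrite /root horner_comp => /factor_theorem[q pE].
have q0 : q != 0 by apply: contraNneq p0 => q0; rewrite pE q0 mul0r.
have [||rs qrs] := IH q q0.
- by rewrite pE size_Mmonic ?monicXsubC // size_XsubC addn2 in pn.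
- by apply: splits_dvd sp; rewrite pE comp_polyM dvdp_mulr.
by exists (g.[z] :: rs); rewrite pE big_cons mulrC eqp_mull.
Qed.

Lemma splits_factor p : p != 0 -> splits p ->
  exists rs : seq F, p = lead_coef p *: \prod_(r <- rs) ('X - r%:P) /\ size rs = (size p).-1.
Proof.
move=> p0 [rs prs]; exists rs; split; last first.
  by rewrite (eqp_size prs) size_prod_XsubC.
by have := eqp_eq prs; rewrite (monicP (monic_prod_XsubC _ _ _)) scale1r.
Qed.
End Splits.

Section Vandermonde.
Variable F : fieldType.

(** The Vandermonde product of three elements, a square root of the discriminant
    with a choice of ordering. *)
Definition vdm (z : 'I_3 -> F) := (z 0 - z 1) * (z 0 - z 2) * (z 1 - z 2).

Lemma ord3P (P : 'I_3 -> Prop) : P 0 -> P 1 -> P 2 -> forall i, P i.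
Proof.
move=> P0 P1 P2 [[|[|[|//]]] i3].
- by rewrite (_ : Ordinal i3 = 0) //; apply: val_inj.
- by rewrite (_ : Ordinal i3 = 1) //; apply: val_inj.
- by rewrite (_ : Ordinal i3 = 2) //; apply: val_inj.
Qed.

Lemma vdm_tperm (z : 'I_3 -> F) i j : i != j -> vdm (fun k => z (tperm i j k)) = - vdm z.
Proof.
have t01 : tperm 0 1 (2 : 'I_3) = 2 by rewrite tpermD.
have t02 : tperm 0 2 (1 : 'I_3) = 1 by rewrite tpermD.
have t12 : tperm 1 2 (0 : 'I_3) = 0 by rewrite tpermD.
have h01 : vdm (fun k => z (tperm 0 1 k)) = - vdm z by rewrite /vdm tpermL tpermR t01; ring.
have h02 : vdm (fun k => z (tperm 0 2 k)) = - vdm z by rewrite /vdm tpermL tpermR t02; ring.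
have h12 : vdm (fun k => z (tperm 1 2 k)) = - vdm z by rewrite /vdm tpermL tpermR t12; ring.
by move: i j; apply: ord3P; apply: ord3P => // _; first [done | by rewrite tpermC].
Qed.

Lemma vdm_perm (z : 'I_3 -> F) (a : {perm 'I_3}) :
  vdm (fun k => z (a k)) = (-1) ^+ odd_perm a * vdm z.
Proof.
have [ts -> dts] := prod_tpermP a; rewrite odd_perm_prod //.
elim: ts dts z => [|t ts IH] /= => [_|/andP[dt dts]] z.
  by rewrite big_nil mul1r /vdm !perm1.
pose z' m := z ((\prod_(t <- ts) tperm t.1 t.2)%g m).
transitivity (vdm (fun k => z' (tperm t.1 t.2 k))).
  by rewrite /vdm /z' !big_cons !permM.
rewrite (vdm_tperm z' dt) (IH dts z); case: odd; rewrite /= expr0 expr1; ring.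
Qed.

Lemma vdm_inj (z : 'I_3 -> F) : vdm z != 0 -> injective z.
Proof.
rewrite /vdm !mulf_eq0 !subr_eq0 !negb_or => /andP[/andP[z01 z02] z12].
by apply: ord3P; apply: ord3P => // /eqP; rewrite ?[z 1 == z 0]eq_sym ?[z 2 == _]eq_sym
  ?(negbTE z01) ?(negbTE z02) ?(negbTE z12).
Qed.

Section Fibre.
Hypothesis two0 : 2 != 0 :> F.
Variables (x : F) (z : 'I_3 -> F).
Hypothesis fibre : fpoly F - x%:P = 2 *: \prod_i ('X - (z i)%:P).

Lemma fpolyE y : (fpoly F).[y] = 2 * y ^+ 3 - 3 * y ^+ 2 + 1.
Proof. by rewrite /fpoly !hornerE. Qed.

Lemma fibre_hornerE y : 2 * y ^+ 3 - 3 * y ^+ 2 + 1 - x = 2 * ((y - z 0) * (y - z 1) * (y - z 2)).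
Proof.
have := congr1 (horner^~ y) fibre; rewrite /= hornerD hornerN hornerC fpolyE => ->.
rewrite hornerZ horner_prod !big_ord_recl big_ord0 mulr1 !hornerXsubC mulrA.
by congr (2 * ((_ - z _) * (_ - z _) * (_ - z _))); apply: val_inj.
Qed.

(** Vieta's formulas, read off from the values at 0, 1 and -1. *)
Lemma fibre_coef : [/\ 2 * (z 0 + z 1 + z 2) = 3, z 0 * z 1 + z 0 * z 2 + z 1 * z 2 = 0
  & 2 * (z 0 * z 1 * z 2) = x - 1].
Proof.
have two := mulfI two0.
have E3 : 2 * (z 0 * z 1 * z 2) = x - 1.
  have -> : 2 * (z 0 * z 1 * z 2) = - (2 * ((0 - z 0) * (0 - z 1) * (0 - z 2))) by ring.
  by rewrite -fibre_hornerE; ring.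
pose r y := 2 * ((y - z 0) * (y - z 1) * (y - z 2)).
have E1 : 2 * 1 ^+ 3 - 3 * 1 ^+ 2 + 1 - x = r 1 := fibre_hornerE 1.
have Em : 2 * (-1) ^+ 3 - 3 * (-1) ^+ 2 + 1 - x = r (-1) := fibre_hornerE (-1).
split=> //; apply: two.
  have -> : 2 * (2 * (z 0 + z 1 + z 2)) = - (r 1 + r (-1)) - 2 * (2 * (z 0 * z 1 * z 2)).
    by rewrite /r; ring.
  by rewrite -E1 -Em E3; ring.
apply: (mulfI two0); have -> : 2 * (2 * (z 0 * z 1 + z 0 * z 2 + z 1 * z 2)) = r 1 - r (-1) - 4.
  by rewrite /r; ring.
by rewrite -E1 -Em; ring.
Qed.

Lemma fibre_root y : 2 * y ^+ 3 - 3 * y ^+ 2 + 1 = x -> exists i, y = z i.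
Proof.
move=> /eqP; rewrite -subr_eq0 fibre_hornerE !mulf_eq0 (negbTE two0) /= !subr_eq0.
by case/orP => [/orP[]|] /eqP ->; [exists 0 | exists 1 | exists 2].
Qed.

Lemma root_fibre i : 2 * z i ^+ 3 - 3 * z i ^+ 2 + 1 = x.
Proof.
apply/eqP; rewrite -subr_eq0 fibre_hornerE; move: i.
by apply: ord3P; rewrite subrr ?(mulr0, mul0r).
Qed.

Lemma vdm_fibre : 4 * vdm z ^+ 2 = 27 * (x * (1 - x)).
Proof.
have [E1 E2 E3] := fibre_coef; have two := mulfI two0.
set e1 := z 0 + z 1 + z 2 in E1; set e2 := _ + _ in E2; set e3 := z 0 * z 1 * z 2 in E3.
have -> : vdm z ^+ 2 = e1 ^+ 2 * e2 ^+ 2 - 4 * e2 ^+ 3 - 4 * e1 ^+ 3 * e3 + 18 * e1 * e2 * e3 - 27 * e3 ^+ 2.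
  by rewrite /vdm /e1 /e2 /e3; ring.
rewrite E2 (_ : x = 2 * e3 + 1); last by rewrite E3 subrK.
have -> : 4 * (e1 ^+ 2 * 0 ^+ 2 - 4 * 0 ^+ 3 - 4 * e1 ^+ 3 * e3 + 18 * e1 * 0 * e3 - 27 * e3 ^+ 2)
  = - (2 * (2 * e1) ^+ 3 * e3) - 108 * e3 ^+ 2 by ring.
by rewrite E1; ring.
Qed.

Lemma prod_fibre : 4 * \prod_i (z i * (1 - z i)) = x * (1 - x).
Proof.
have [E1 E2 E3] := fibre_coef.
have -> : \prod_i (z i * (1 - z i)) = (z 0 * z 1 * z 2) * ((1 - z 0) * (1 - z 1) * (1 - z 2)).
  rewrite !big_ord_recl big_ord0 mulr1.
  rewrite (_ : lift ord0 (lift ord0 ord0) = 2); last exact: val_inj.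
  by rewrite (_ : lift ord0 ord0 = 1); last exact: val_inj; rewrite (_ : ord0 = 0) //; ring.
have E := fibre_hornerE 1.
rewrite (_ : 4 * _ = (2 * (z 0 * z 1 * z 2)) * (2 * ((1 - z 0) * (1 - z 1) * (1 - z 2)))); last by ring.
by rewrite -E E3; ring.
Qed.
End Fibre.
End Vandermonde.

(** * Labelling the iterated preimages *)

Section Labelling.
Variable F : fieldType.
Hypothesis two0 : 2 != 0 :> F.
Hypothesis three0 : 3 != 0 :> F.
Local Notation f := (fpoly F).

(** The square of the Vandermonde product of the three preimages of x. *)
Definition disc (x : F) := 27 / 4 * (x * (1 - x)).
(** A square root of [disc] multiplied over x and its three preimages, by
    [disc_product]. *)
Definition disc2 (x : F) := 729 / 32 * (x * (1 - x)).

Let four0 : 4 != 0 :> F.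
Proof. by rewrite (_ : 4 = 2 * 2) ?mulf_neq0 //; ring. Qed.

Lemma cubic_fibre x : splits (f - x%:P) -> exists z, f - x%:P = 2 *: \prod_(i : 'I_3) ('X - (z i)%:P).
Proof.
have sf : size (f - x%:P) = 4 by have := size_iter_sub two0 1 x; rewrite /iter_poly /= comp_polyXr.
have f0 : f - x%:P != 0 by rewrite -size_poly_eq0 sf.
move=> /(splits_factor f0)[rs [E srs]]; rewrite sf in srs.
have lc : lead_coef (f - x%:P) = 2.
  by rewrite lead_coefE sf /fpoly /= !(coefB, coefD, coefZ, coefXn, coefC, coef1) /= mulr1 mulr0 !subr0 addr0.
by exists (fun i => rs`_i); rewrite {1}E lc (big_nth 0) srs big_mkord.
Qed.

Lemma vdm_disc x z : f - x%:P = 2 *: \prod_(i : 'I_3) ('X - (z i)%:P) -> vdm z ^+ 2 = disc x.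
Proof.
move=> /(vdm_fibre two0) E; apply: (mulfI four0); rewrite E /disc.
by field.
Qed.

Definition labelling n x (lam : seq 'I_3 -> F) := lam [::] = x /\
  forall u, (size u < n)%N -> f - (lam u)%:P = 2 *: \prod_(i : 'I_3) ('X - (lam (rcons u i))%:P).

Definition Delta (lam : seq 'I_3 -> F) u := vdm (fun i => lam (rcons u i)).

Lemma disc_product x z : f - x%:P = 2 *: \prod_(i : 'I_3) ('X - (z i)%:P) ->
  disc x * \prod_i disc (z i) = disc2 x ^+ 2.
Proof.
move=> /(prod_fibre two0) E; rewrite /disc big_split /=.
have -> : \prod_(i < 3) (27 / 4) = (27 / 4 : F) ^+ 3 by rewrite prodr_const card_ord.
have -> : \prod_i (z i * (1 - z i)) = x * (1 - x) / 4.
  by apply: (mulfI four0); rewrite E mulrCA divff ?mulr1.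
have t32 : 32 != 0 :> F by rewrite (_ : 32 = 2 ^+ 5) ?expf_neq0 //; ring.
by rewrite /disc2; field; rewrite ?two0 ?four0 ?t32.
Qed.

Lemma iter_sub_comp n x : iter_poly f n.+1 - x%:P = (f - x%:P) \Po iter_poly f n.
Proof. by rewrite iter_polyS comp_polyB comp_polyC. Qed.

Lemma splits_fibre n x : splits (iter_poly f n.+1 - x%:P) -> splits (f - x%:P).
Proof.
rewrite iter_sub_comp; apply: splits_comp.
  have := size_iter_sub two0 1 x; rewrite /iter_poly /= comp_polyXr => sf.
  by rewrite -size_poly_eq0 sf.
by rewrite size_iter_poly // ltnS expn_gt0.
Qed.

Lemma splits_branch n x z i : f - x%:P = 2 *: \prod_(i : 'I_3) ('X - (z i)%:P) ->
  splits (iter_poly f n.+1 - x%:P) -> splits (iter_poly f n - (z i)%:P).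
Proof.
move=> E; rewrite iter_sub_comp; apply: splits_dvd.
have -> : iter_poly f n - (z i)%:P = ('X - (z i)%:P) \Po iter_poly f n.
  by rewrite comp_polyB comp_polyX comp_polyC.
by apply: dvdp_comp_poly; rewrite E dvdpZr // (bigD1 i) //= dvdp_mulr.
Qed.

(** The numbering is chosen from the root downwards.  The square roots [delta] of
    the discriminants at the children of x can be prescribed arbitrarily, since
    exchanging two preimages changes the sign of their Vandermonde product; they
    are prescribed so that the relation at x holds. *)
Lemma labelling_exists n x delta : splits (iter_poly f n - x%:P) ->
  ((0 < n)%N -> delta ^+ 2 = disc x) ->
  exists lam, [/\ labelling n x lam, (0 < n)%N -> Delta lam [::] = delta &
    forall u, ((size u).+1 < n)%N -> Delta lam u * \prod_i Delta lam (rcons u i) = disc2 (lam u)].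
Proof.
elim: n x delta => [|n IH] x delta sp dx; first by exists (fun=> x).
have [z0 E0] := cubic_fibre (splits_fibre sp).
have [z E vz] : exists2 z, f - x%:P = 2 *: \prod_(i : 'I_3) ('X - (z i)%:P) & vdm z = delta.
  have /eqP := vdm_disc E0; rewrite -(dx isT) eqf_sqr => /orP[/eqP|/eqP] vz; first by exists z0.
  exists (fun k => z0 (tperm 0 1 k)); last by rewrite vdm_tperm // vz opprK.
  by rewrite E0; congr (_ *: _); rewrite [LHS](reindex_inj (@perm_inj _ (tperm 0 1))).
(* Square roots of the discriminants at the children, with the product prescribed
   by x; for n = 0 the children are leaves and nothing is required. *)
have [dl dlz dlx] : exists2 dl : 'I_3 -> F, (0 < n)%N -> forall i, dl i ^+ 2 = disc (z i) &
    (0 < n)%N -> delta * \prod_i dl i = disc2 x.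
  case: n sp dx {IH} => [|n] sp dx; first by exists (fun=> 0).
  have ex i : exists w, w ^+ 2 == disc (z i).
    have [w /vdm_disc wz] := cubic_fibre (splits_fibre (splits_branch i E sp)).
    by exists (vdm w); apply/eqP.
  pose d0 i := xchoose (ex i); have d0E i : d0 i ^+ 2 = disc (z i) by apply/eqP/(xchooseP (ex i)).
  have : (delta * \prod_i d0 i) ^+ 2 == disc2 x ^+ 2.
    by rewrite exprMn (dx isT) -prodrXl -(disc_product E); apply/eqP; congr (_ * _); apply: eq_bigr.
  rewrite eqf_sqr => /orP[/eqP|/eqP] s; first by exists d0.
  exists (fun i => if i == 0 then - d0 i else d0 i).
    by move=> _ i; case: ifP => _; rewrite ?sqrrN d0E.
  move=> _; have -> : \prod_i (if i == 0 then - d0 i else d0 i) = - \prod_i d0 i.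
    rewrite (bigD1 0) //= [in RHS](bigD1 0) //= mulNr; congr (- (_ * _)).
    by apply: eq_bigr => i /negbTE ->.
  by rewrite mulrN s opprK.
have ih i : exists lam, [/\ labelling n (z i) lam, (0 < n)%N -> Delta lam [::] = dl i &
    forall u, ((size u).+1 < n)%N -> Delta lam u * \prod_i Delta lam (rcons u i) = disc2 (lam u)].
  by apply: IH => [|n0]; [apply: splits_branch sp | apply: dlz].
have [lams lamsP] := fin_all_exists ih.
exists (fun u => if u is i :: u' then lams i u' else x); split.
- split=> // -[|i u] un /=.
    rewrite E; congr (_ *: _); apply: eq_bigr => i _.
    by have [[-> _] _ _] := lamsP i.
  by have [[_ h] _ _] := lamsP i; rewrite h.
- move=> _; rewrite -vz /Delta /vdm /=.
  by have [[-> _] _ _] := lamsP 0; have [[-> _] _ _] := lamsP 1; have [[-> _] _ _] := lamsP 2.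
move=> [|i u] un; last by have [_ _ h] := lamsP i; rewrite -h.
rewrite /= -(dlx un); congr (_ * _).
  rewrite -vz /Delta /vdm /=.
  by have [[-> _] _ _] := lamsP 0; have [[-> _] _ _] := lamsP 1; have [[-> _] _ _] := lamsP 2.
by apply: eq_bigr => i _; have [_ h _] := lamsP i; rewrite -(h un).
Qed.
End Labelling.

(** * The Galois action on a labelled tree *)

Section LabelProps.
Variable F : fieldType.
Hypothesis two0 : 2 != 0 :> F.
Hypothesis three0 : 3 != 0 :> F.
Local Notation f := (fpoly F).
Variables (n : nat) (x : F) (lam : seq 'I_3 -> F).
Hypothesis lamP : labelling n x lam.
Hypothesis x0 : x != 0.
Hypothesis x1 : x != 1.

Lemma label_parent u i : (size u < n)%N ->
  2 * lam (rcons u i) ^+ 3 - 3 * lam (rcons u i) ^+ 2 + 1 = lam u.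
Proof. by case: lamP => _ /(_ u) h /h/(root_fibre)/(_ i). Qed.

Lemma label_child u y : (size u < n)%N -> 2 * y ^+ 3 - 3 * y ^+ 2 + 1 = lam u ->
  exists i, y = lam (rcons u i).
Proof. by case: lamP => _ /(_ u) h /h/(fibre_root two0); apply. Qed.

Lemma label_noncritical u : (size u <= n)%N -> lam u != 0 /\ lam u != 1.
Proof.
elim/last_ind: u => [_|u i IH]; first by case: lamP => ->.
rewrite size_rcons => un; have [l0 l1] := IH (ltnW un).
split; [apply: contraNneq l1 | apply: contraNneq l0] => E;
  by rewrite -(label_parent i un) E; apply/eqP; ring.
Qed.

Lemma Delta_sqr u : (size u < n)%N -> Delta lam u ^+ 2 = disc (lam u).
Proof. by case: lamP => _ h un; apply: (vdm_disc two0 (h u un)). Qed.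

Lemma disc_neq0 (y : F) : y != 0 -> y != 1 -> disc y != 0.
Proof.
move=> y0 y1; rewrite /disc !mulf_neq0 ?invr_neq0 //.
- by rewrite (_ : 27 = 3 ^+ 3) ?expf_neq0 //; ring.
- by rewrite (_ : 4 = 2 ^+ 2) ?expf_neq0 //; ring.
- by rewrite subr_eq0 eq_sym.
Qed.

Lemma Delta_neq0 u : (size u < n)%N -> Delta lam u != 0.
Proof.
move=> un; have [l0 l1] := label_noncritical (ltnW un).
by have := disc_neq0 l0 l1; rewrite -Delta_sqr // expf_eq0.
Qed.

Lemma label_inj u v : (size u <= n)%N -> size u = size v -> lam u = lam v -> u = v.
Proof.
elim/last_ind: u v => [|u i IH] v; first by move=> _ /esym/size0nil ->.
case/lastP: v => [|v j]; rewrite !size_rcons // => un [uv] E.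
have uv' : u = v.
  by apply: IH => //; [exact: ltnW | rewrite -(label_parent i un) E label_parent -?uv].
by rewrite -{}uv' in E *; rewrite (vdm_inj (Delta_neq0 un) E).
Qed.

(** Each application of f is one step towards the root. *)
Lemma label_iterP k : (k <= n)%N -> forall z, (iter_poly f k).[z] = x <->
  exists2 u, size u = k & z = lam u.
Proof.
have evE k' z : (iter_poly f k').[z] = iter k' (fun y => 2 * y ^+ 3 - 3 * y ^+ 2 + 1) z.
  by elim: k' => [|k' IH]; rewrite ?hornerX // iter_polyS horner_comp IH fpolyE.
have [lx _] := lamP.
elim: k => [|k IH] kn z; rewrite evE.
  split=> [zx|[u /size0nil -> ->] //]; exists [::] => //.
  by rewrite lx -zx.
rewrite iterSr -evE; split.
  move/(IH (ltnW kn)) => [u uk] /esym Eu; have un : (size u < n)%N by rewrite uk.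
  have [i ->] := label_child un (esym Eu); exists (rcons u i) => //.
  by rewrite size_rcons uk.
case; case/lastP => [//|u i]; rewrite size_rcons => -[uk] ->.
by apply/(IH (ltnW kn)); exists u => //; apply: label_parent; rewrite uk.
Qed.
End LabelProps.

Section GaloisAction.
Variables (K : fieldType) (L : splittingFieldType K) (n : nat) (x : L) (lam : seq 'I_3 -> L).
Hypothesis two0 : 2 != 0 :> L.
Hypothesis three0 : 3 != 0 :> L.
Hypothesis lamP : labelling n x lam.
Hypothesis x0 : x != 0.
Hypothesis x1 : x != 1.
Hypothesis xK : x \in 1%VS.
Local Notation G := ('Gal({:L} / 1))%g.

Lemma gal_fpoly (s : gal_of {:L}) (y : L) :
  2 * s y ^+ 3 - 3 * s y ^+ 2 + 1 = s (2 * y ^+ 3 - 3 * y ^+ 2 + 1).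
Proof. by rewrite rmorphD rmorphB rmorph1 !(rmorphM, rmorphXn, rmorph_nat). Qed.

Lemma gal_label (s : gal_of {:L}) u : s \in G -> (size u <= n)%N ->
  exists2 v, size v = size u & lam v = s (lam u).
Proof.
move=> sG; elim/last_ind: u => [_|u i IH].
  by exists [::] => //; case: lamP => -> _; rewrite (fixed_gal (sub1v _) sG).
rewrite size_rcons => un; have [v vu vE] := IH (ltnW un).
have vn : (size v < n)%N by rewrite vu.
have [|j E] := label_child two0 lamP (y := s (lam (rcons u i))) vn.
  by rewrite gal_fpoly (label_parent lamP) // vE.
by exists (rcons v j); rewrite ?size_rcons ?vu.
Qed.

(** The default value u is not taken for s in the Galois group, by [gal_label]. *)
Definition treeact_fun (s : gal_of {:L}) (u : vertex 3 n) : vertex 3 n :=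
  odflt u [pick v : vertex 3 n | (size v == size u) && (lam v == s (lam u))].

Lemma treeact_funP s u : s \in G -> size (treeact_fun s u) = size u /\ lam (treeact_fun s u) = s (lam u).
Proof.
move=> sG; rewrite /treeact_fun; case: pickP => [v /andP[/eqP ? /eqP] //|none].
have [v vu vE] := gal_label sG (size_bseq u).
have vn : (size v <= n)%N by rewrite vu size_bseq.
by have := none (Bseq vn); rewrite /= vu vE !eqxx.
Qed.

Lemma treeact_inj (s : gal_of {:L}) : injective (if s \in G then treeact_fun s else id).
Proof.
case: ifP => sG // u v E.
have [su lu] := treeact_funP u sG; have [sv lv] := treeact_funP v sG.
apply: val_inj; apply: (label_inj two0 three0 lamP x0 x1) => //=.
- exact: size_bseq.
- by rewrite -su E sv.
- by apply: (fmorph_inj s); apply: etrans (esym lu) _; rewrite E; exact: lv.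
Qed.

Definition treeact (s : gal_of {:L}) : {perm vertex 3 n} := perm (@treeact_inj s).

Lemma ap_treeact s u : s \in G -> (size u <= n)%N ->
  size (ap (treeact s) u) = size u /\ lam (ap (treeact s) u) = s (lam u).
Proof.
move=> sG un; rewrite -[u]/(val (Bseq un)) apE permE sG.
exact: treeact_funP.
Qed.

Lemma ap_treeact_eq s u v : s \in G -> (size u <= n)%N -> size v = size u -> lam v = s (lam u) ->
  ap (treeact s) u = v.
Proof.
move=> sG un vu vE; have [h1 h2] := ap_treeact sG un.
by apply: (label_inj two0 three0 lamP x0 x1); rewrite ?h1 ?h2.
Qed.

Lemma treeactM : {in G &, {morph treeact : s t / (s * t)%g}}.
Proof.
move=> s t sG tG; apply: ap_eq => u un; rewrite apM.
have [h1 h2] := ap_treeact sG un.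
have sn : (size (ap (treeact s) u) <= n)%N by rewrite h1.
have [k1 k2] := ap_treeact tG sn.
by apply: ap_treeact_eq; rewrite ?groupM // ?k1 // k2 h2 galM ?memvf.
Qed.

Canonical treeact_morphism := Morphism treeactM.

Lemma treeact_tree s : s \in G -> treeact s \in tree_aut 3 n.
Proof.
move=> sG; apply: tree_autP => [u /(ap_treeact sG)[] //|u i un].
have [h1 h2] := ap_treeact sG (ltnW un).
have uin : (size (rcons u i) <= n)%N by rewrite size_rcons.
have sn : (size (ap (treeact s) u) < n)%N by rewrite h1.
have [|j jE] := label_child two0 lamP (y := s (lam (rcons u i))) sn.
  by rewrite gal_fpoly (label_parent lamP) // h2.
by exists j; apply: ap_treeact_eq => //; rewrite !size_rcons h1.
Qed.

Lemma treeact_Delta s u : s \in G -> (size u < n)%N ->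
  s (Delta lam u) = (-1) ^+ odd_perm (loc (treeact s) u) * Delta lam (ap (treeact s) u).
Proof.
move=> sG un; rewrite /Delta -vdm_perm /vdm.
have E i : lam (rcons (ap (treeact s) u) (loc (treeact s) u i)) = s (lam (rcons u i)).
  have uin : (size (rcons u i) <= n)%N by rewrite size_rcons.
  by rewrite -ap_rcons ?treeact_tree //; have [_ ->] := ap_treeact sG uin.
by rewrite !E !rmorphM !rmorphB.
Qed.

Hypothesis lamD : forall u, ((size u).+1 < n)%N ->
  Delta lam u * \prod_i Delta lam (rcons u i) = disc2 (lam u).

Lemma gal_disc2 (s : gal_of {:L}) y : s (disc2 y) = disc2 (s y).
Proof. by rewrite /disc2 !rmorphM rmorphB fmorphV rmorph1 !rmorph_nat. Qed.

Lemma disc2_neq0 (y : L) : y != 0 -> y != 1 -> disc2 y != 0.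
Proof.
move=> y0 y1; rewrite /disc2 !mulf_neq0 ?invr_neq0 //.
- by rewrite (_ : 729 = 3 ^+ 6) ?expf_neq0 //; ring.
- by rewrite (_ : 32 = 2 ^+ 5) ?expf_neq0 //; ring.
- by rewrite subr_eq0 eq_sym.
Qed.

(** Apply s to the relation that characterizes the labelling and compare with the
    same relation at the image of u: the local signs must cancel. *)
Lemma treeact_sign s u : s \in G -> ((size u).+2 <= n)%N ->
  odd_perm (loc (treeact s) u) (+) \big[addb/false]_i odd_perm (loc (treeact s) (rcons u i)) = false.
Proof.
move=> sG un; have un1 := ltnW un; have sT := treeact_tree sG.
have [h1 h2] := ap_treeact sG (ltnW un1).
set b := _ (+) _.
have E : s (disc2 (lam u)) = (-1) ^+ b * disc2 (s (lam u)).
  rewrite -h2 -lamD // -lamD ?h1 // rmorphM rmorph_prod /= treeact_Delta //.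
  rewrite [X in _ * X = _](eq_bigr (fun i => (-1) ^+ odd_perm (loc (treeact s) (rcons u i)) *
      Delta lam (rcons (ap (treeact s) u) (loc (treeact s) u i)))); last first.
    by move=> i _; rewrite treeact_Delta ?size_rcons // ap_rcons.
  have sgE : (-1) ^+ (\big[addb/false]_i odd_perm (loc (treeact s) (rcons u i))) =
      \prod_i (-1) ^+ odd_perm (loc (treeact s) (rcons u i)) :> L.
    by apply: (big_morph (fun b : bool => (-1) ^+ b : L)) => [c c'|]; rewrite ?signr_addb ?expr0.
  rewrite big_split /= -sgE.
  rewrite -(reindex_inj (@perm_inj _ (loc (treeact s) u)) (P := predT)
      (F := fun i => Delta lam (rcons (ap (treeact s) u) i))) /=.
  by rewrite /b signr_addb mulrACA.
case: {+}b E => //; rewrite gal_disc2 expr1 mulN1r => /eqP.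
have sn : (size (ap (treeact s) u) <= n)%N by rewrite h1 ltnW.
have [l0 l1] := label_noncritical lamP x0 x1 sn.
rewrite -subr_eq0 opprK -mulr2n -mulr_natl mulf_eq0 (negbTE two0) /= => /eqP E.
by have := disc2_neq0 l0 l1; rewrite h2 E eqxx.
Qed.
End GaloisAction.

(** * The Galois group *)

Lemma map_iter_sub (F : fieldType) (L : fieldType) (phi : {rmorphism F -> L}) k a :
  map_poly phi (iter_poly (fpoly F) k - a%:P) = iter_poly (fpoly L) k - (phi a)%:P.
Proof.
rewrite rmorphB /= map_polyC /=; congr (_ - _).
elim: k => [|k IH]; first by rewrite map_polyX.
rewrite !iter_polyS map_comp_poly IH; congr (_ \Po _).
by rewrite /fpoly rmorphD rmorphB /= !map_polyZ !map_polyXn rmorph1 !rmorph_nat.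
Qed.

(** All that is used about the primes: irreducibility of the f^k - a and the two
    nonsquareness statements. *)
Section Main.
Variables (K : fieldExtType rat) (L : splittingFieldType K) (a : K) (n : nat).
Local Notation x := (in_alg L a).
Local Notation F k := (iter_poly (fpoly K) k - a%:P).
Local Notation G := ('Gal({:L} / 1))%g.
Hypothesis irr : forall k, irreducible_poly (F k).
Hypothesis nonsq1 : forall k (y : L) (h : {poly K}),
  (map_poly (in_alg L) (F k)).[y] = 0 ->
  (map_poly (in_alg L) h).[y] ^+ 2 = 3 * y * (1 - y) -> False.
Hypothesis nonsq2 : forall k (y : L) (h : {poly K}),
  (map_poly (in_alg L) (F k)).[y] = 0 ->
  let z := 2 * y ^+ 3 - 3 * y ^+ 2 + 1 in
  (map_poly (in_alg L) h).[y] ^+ 2 = (3 * z * (1 - z)) * (3 * y * (1 - y)) -> False.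
Hypothesis a0 : a != 0.
Hypothesis a1 : a != 1.
Hypothesis splitL : splitting_field (F n.+1) L.

Let natL m : (m%:R == 0 :> L) = (m == 0)%N.
Proof. by rewrite -(rmorph_nat (in_alg L)) fmorph_eq0 natr_eq0K. Qed.
Let two0 : 2 != 0 :> L. Proof. by rewrite natL. Qed.
Let three0 : 3 != 0 :> L. Proof. by rewrite natL. Qed.
Let x0 : x != 0. Proof. by rewrite fmorph_eq0. Qed.
Let x1 : x != 1. Proof. by rewrite -(rmorph1 (in_alg L)) (inj_eq (fmorph_inj _)). Qed.
Let xK : x \in 1%VS. Proof. exact: memvZ (mem1v _). Qed.

Let splitsL : splits (iter_poly (fpoly L) n.+1 - x%:P).
Proof. by have [rs prs _] := splitL; exists rs; rewrite -map_iter_sub. Qed.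

Section Labelled.
Variable lam : seq 'I_3 -> L.
Hypothesis lamP : labelling n.+1 x lam.
Hypothesis lamD : forall u, ((size u).+1 < n.+1)%N ->
  Delta lam u * \prod_i Delta lam (rcons u i) = disc2 (lam u).

Local Notation tact := (@treeact K L n.+1 x lam two0 three0 lamP x0 x1 xK).

Let root_lam u : (size u <= n.+1)%N -> (map_poly (in_alg L) (F (size u))).[lam u] = 0.
Proof.
move=> un; rewrite map_iter_sub !hornerE.
have /(label_iterP two0 lamP un) -> : exists2 v, size v = size u & lam u = lam v by exists u.
by rewrite subrr.
Qed.

Let charL : [pchar L] =i pred0.
Proof.
move=> l; rewrite !inE; apply/negP => /andP[lp]; rewrite natL => /eqP l0.
by rewrite l0 in lp.
Qed.

Let galoisL (M : {subfield L}) : galois M {:L}.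
Proof.
apply/and3P; split; first exact: subvf; last exact: normalFieldf.
by apply/separableP => y _; apply: pcharf0_separable charL _.
Qed.

Let adjoin_poly (y w : L) : w \in <<1; y>>%VS -> exists h : {poly K}, w = (map_poly (in_alg L) h).[y].
Proof. by move=> /Fadjoin_polyP[p /polyOver1P[h ->] ->]; exists h. Qed.

Let evalZ c (h : {poly K}) y :
  (map_poly (in_alg L) (c *: h)).[y] = GRing.in_alg L c * (map_poly (in_alg L) h).[y].
Proof. by rewrite map_polyZ hornerZ. Qed.

(** Galois correspondence over the field generated by the label of u. *)
Let moving u (w : L) : (size u <= n.+1)%N -> w \notin <<1; lam u>>%VS ->
  exists2 s, s \in G & ap (tact s) u = u /\ s w != w.
Proof.
move=> un; have /galois_fixedField <- := galoisL <<1; lam u>>%AS.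
move=> wn; have [s sG sw] : exists2 s, s \in 'Gal({:L} / <<1; lam u>>)%g & s w != w.
  apply/exists_inP; apply: contraR wn => /exists_inPn h.
  by apply/fixedFieldP; rewrite ?memvf // => s /h; rewrite negbK => /eqP.
have s1 : s \in G by apply: (subsetP (galS _ (sub1v _))) sG.
exists s => //; split=> //.
apply: (ap_treeact_eq two0 three0 lamP x0 x1 xK s1 un) => //.
by rewrite (fixed_gal (subvf _) sG) ?memv_adjoin.
Qed.

(** The square roots Delta witness the nonsquareness: an automorphism that fixes the
    label of u and moves Delta u is odd at u, and likewise for edges. *)
Let act_full : (tact @* G)%g = E2 3 n.+1.
Proof.
apply: E2_generated.
- apply/subsetP => _ /morphimP[s _ sG ->]; apply: mem_E2_of_signs; first exact: treeact_tree.
  by move=> u un; apply: treeact_sign.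
- move=> u v uv un.
  have qy : root (minPoly 1 (lam u)) (lam v).
    have /polyOver1P[q qE] := minPolyOver 1 (lam u).
    have : F (size u) %| q.
      apply: (irreducible_root_dvd (phi := in_alg L) (z := lam u) (irr _)).
        exact: root_lam.
      by rewrite -qE; apply/eqP/root_minPoly.
    rewrite qE -(dvdp_map (in_alg L)) => /dvdpP[r ->].
    by rewrite rootM; apply/orP; right; rewrite uv; apply/eqP/root_lam; rewrite -uv.
  have [s sG su] := normalField_root_minPoly (subvf _) (normalFieldf _) (memvf _) qy.
  exists (tact s); first exact: mem_morphim.
  by apply: ap_treeact_eq; rewrite // su.
- move=> u un.
  have [|s sG [su sD]] := @moving u (Delta lam u) (ltnW un).
    apply/negP => /adjoin_poly[h hE].
    apply: (nonsq1 (h := (2 / 3) *: h) (root_lam (ltnW un))).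
    have cE : GRing.in_alg L (2 / 3) = 2 / 3 by rewrite fmorph_div !rmorph_nat.
    rewrite evalZ exprMn -hE (Delta_sqr two0 lamP) // cE /disc.
    by field; rewrite ?natL.
  exists (tact s); first exact: mem_morphim.
  split=> //; move: sD; rewrite (treeact_Delta two0 three0 lamP x0 x1 xK) // su; case: odd_perm => //.
  by rewrite expr0 mul1r eqxx.
move=> u i un; have uin : (size (rcons u i) < n.+1)%N by rewrite size_rcons.
have [|s sG [su sD]] := @moving (rcons u i) (Delta lam u * Delta lam (rcons u i)) (ltnW uin).
  apply/negP => /adjoin_poly[h hE].
  apply: (nonsq2 (h := (4 / 9) *: h) (root_lam (ltnW uin))).
  have cE : GRing.in_alg L (4 / 9) = 4 / 9 by rewrite fmorph_div !rmorph_nat.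
  rewrite (label_parent lamP) ?(ltnW un) //.
  rewrite evalZ exprMn -hE exprMn !(Delta_sqr two0 lamP) ?(ltnW un) // cE /disc.
  by field; rewrite ?natL.
exists (tact s); first exact: mem_morphim.
split=> //; move: sD; rewrite rmorphM /= !(treeact_Delta two0 three0 lamP x0 x1 xK) ?(ltnW un) // su.
have -> : ap (tact s) u = u.
  have [sz _] := ap_treeact two0 three0 lamP x0 x1 xK sG (ltnW (ltnW un)).
  by move: su; rewrite ap_rcons ?treeact_tree ?(ltnW un) // => /rcons_inj[].
rewrite mulrACA -signr_addb; case: (_ (+) _) => //.
by rewrite expr0 mul1r eqxx.
Qed.

(** An automorphism fixing all the leaves fixes a set of generators of L. *)
Let act_injm : ('injm tact)%g.
Proof.
apply/subsetP => s /[dup] sK; rewrite inE => /andP[sG _]; rewrite inE.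
have s1 : tact s = 1%g by apply: mker sK.
have fixl u : (size u <= n.+1)%N -> s (lam u) = lam u.
  move=> un; have [_ <-] := ap_treeact two0 three0 lamP x0 x1 xK sG un.
  by rewrite s1 ap1.
apply/gal_eqP => w _; rewrite gal_id.
have [rs prs gen] := splitL.
have sub : (<<1 & rs>> <= fixedField [set s])%VS.
  apply/Fadjoin_seqP; split; first exact: sub1v.
  move=> r rrs; apply/fixedFieldP; rewrite ?memvf // => t; rewrite inE => /eqP ->.
  have rr : root (iter_poly (fpoly L) n.+1 - x%:P) r.
    by rewrite -map_iter_sub (eqp_root prs) root_prod_XsubC.
  move: rr; rewrite /root !hornerE subr_eq0 => /eqP /(label_iterP two0 lamP (leqnn _))[u un ->].
  by apply: fixl; rewrite un.
have : w \in fixedField [set s] by apply: (subvP sub); rewrite gen memvf.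
by move/(fixedFieldP (memvf _)); apply; rewrite inE.
Qed.

Lemma gal_isog_of_labelling : G \isog E2 3 n.+1.
Proof. by rewrite -act_full; apply: sub_isog. Qed.
End Labelled.

Lemma gal_isog : G \isog E2 3 n.+1.
Proof.
have [z /(vdm_disc two0) zd] := cubic_fibre two0 (splits_fibre two0 splitsL).
have [lam [lamP _ lamD]] := labelling_exists two0 splitsL (fun _ => zd).
exact: gal_isog_of_labelling lamP lamD.
Qed.
End Main.
Theorem theorem1p3 (K : fieldExtType rat)
    (p q : K -> Prop) (vp vq : K -> int) (alpha : K) :
  prime_ideal p -> lies_above p 2 -> normalized_valuation p vp ->
  prime_ideal q -> lies_above q 3 -> normalized_valuation q vq ->
  (vq alpha = 1 \/ vq (1 - alpha) = 1) ->
  (vp alpha = 1 \/ vp (1 - alpha) = 1) ->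
  forall n : nat, (0 < n)%N ->
    irreducible_poly (iter_poly (fpoly K) n - alpha%:P) /\
    (forall L : splittingFieldType K,
       splitting_field (iter_poly (fpoly K) n - alpha%:P) L ->
       'Gal({:L} / 1) \isog E2 3 n).
Proof.
move=> _ p2 pv _ q3 qv hq hp [//|n] _.
have [d [vd nd]] := near_critical pv hp; have [e [ve ne]] := near_critical qv hq.
have irr k : irreducible_poly (iter_poly (fpoly K) k - alpha%:P).
  exact: (iter_irreducible q3 qv k ve ne erefl).
split=> // L splitL; apply: gal_isog splitL => //.
- by move=> k y h y0; apply: (disc_nonsquare p2 pv vd nd (irr k) y0 erefl).
- by move=> k y h y0; apply: (disc_prod_nonsquare p2 pv vd nd (irr k) y0 erefl).
- apply: contra_eqN vd => /eqP ->; case: (d); last by rewrite subr0 (nval0 pv).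
  by rewrite sub0r (valN1 (nvalM pv)).
apply: contra_eqN vd => /eqP ->; case: (d); first by rewrite subrr (nval0 pv).
by rewrite subr0 (val1 (nvalM pv)).
Qed.
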